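(* Let $(f,\xi)$ be an equiaffine pair representing a line congruence for which $0$ is a regular value of the discriminant $\delta$. Let $p$ be a discriminant point, i.e. $\delta(p)=0$, let $\lambda$ be the double eigenvalue of the shape operator at $p$, assume $\lambda\ne0$, and put $Z=f(p)+\lambda^{-1}\xi(p)$. Then $p$ is an $A_2$ point of the support function $\rho(\cdot,Z)$ if and only if $p$ is a regular point of the discriminant curve, i.e. the unique principal direction at $p$ is not tangent to the curve $\delta=0$.
   Context: A line congruence is given by a pair $(f,\xi)$, where $f:U\to\mathbb{R}^3$ is a smooth immersion of an open set $U\subset\mathbb{R}^2$ and $\xi:U\to\mathbb{R}^3$ is smooth and transversal to $f$; the lines are $t\mapsto f(u,v)+t\xi(u,v)$. Write $D_X\xi=-f_*(SX)+\tau(X)\xi$ and $D_Xf_*Y=f_*(\nabla_XY)+h(X,Y)\xi$, with shape operator $S=\begin{pmatrix}a&b\\ c&d\end{pmatrix}$, $1$-form $\tau$ and symmetric bilinear form $h$. The pair is equiaffine if $\tau=0$ and $h$ is non-degenerate. The discriminant is $\delta=(a-d)^2+4bc$. When $0$ is a regular value of $\delta$, the set $\delta=0$ is a regular curve (the discriminant curve), and at each of its points $S$ has a double eigenvalue with a one-dimensional eigenspace, called the principal direction. For an equiaffine pair, the co-normal $\nu$ is defined by $\nu\cdot f_u=\nu\cdot f_v=0$, $\nu\cdot\xi=1$, and the support function is $\rho(u,v,Z)=\nu(u,v)\cdot(Z-f(u,v))$, $Z\in\mathbb{R}^3$. The point $p$ is an $A_k$ point of $\rho(\cdot,Z)$ if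 $p$ is a critical point of $(u,v)\mapsto\rho(u,v,Z)$ and the germ at $p$ is, up to an additive constant and a smooth change of coordinates in the source, $\pm x^{k+1}\pm y^2$. *)

(* Defs.v *)
From HB Require Import structures.
From mathcomp Require Export all_boot all_order all_algebra.
From mathcomp Require Export all_classical all_reals all_analysis.
Set Implicit Arguments.
Unset Strict Implicit.
Unset Printing Implicit Defensive.
Import Order.TTheory GRing.Theory Num.Theory.
Export numFieldNormedType.Exports.
Local Open Scope classical_set_scope.
Local Open Scope ring_scope.

Section Smoothness.
Variables (R : realType) (V W : normedModType R).

(* Meant for A open.  All directional derivatives of order n are continuous
   on A, those of order < n being Frechet differentiable there. *)
Fixpoint Cn (n : nat) (A : set V) (g : V -> W) : Prop :=
  if n is m.+1 then
    (forall x, A x -> differentiable g x) /\ (forall v, Cn m A ('D_v g))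
  else forall x, A x -> {for x, continuous g}.

Definition smooth_on (A : set V) (g : V -> W) : Prop := forall n, Cn n A g.

Definition critical_point (g : V -> W) (p : V) : Prop := is_diff p g 0.

End Smoothness.

Section Planar.
Variable R : realType.
Implicit Types (p q X : 'rV[R]_2) (A B : set 'rV[R]_2).

Definition diffeomorphism A B (phi psi : 'rV[R]_2 -> 'rV[R]_2) : Prop :=
  [/\ open A, open B, smooth_on A phi & smooth_on B psi] /\
  [/\ forall x, A x -> B (phi x), forall y, B y -> A (psi y),
      forall x, A x -> psi (phi x) = x & forall y, B y -> phi (psi y) = y].

(* psi is the change of coordinates, sending the origin to p. *)
Definition Ak_point (k : nat) (g : 'rV[R]_2 -> R) p : Prop :=
  critical_point g p /\
  exists A B phi psi (c : R) (s t : bool),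
    [/\ diffeomorphism A B phi psi, B 0, psi 0 = p &
        forall y, B y ->
          g (psi y) = c + (-1) ^+ s * y 0 0 ^+ k.+1 + (-1) ^+ t * y 0 1 ^+ 2].

(* For c a regular value the differential of a scalar function is onto iff it
   is nonzero. *)
Definition regular_value (U : set 'rV[R]_2) (g : 'rV[R]_2 -> R) (c : R) : Prop :=
  forall q, U q -> g q = c -> exists v, 'd g q v != 0.

(* X is the velocity at p of a smooth curve contained in C. *)
Definition tangent_to (C : set 'rV[R]_2) p X : Prop :=
  exists (I : set R) (gamma : R -> 'rV[R]_2),
    [/\ open I, I 0, smooth_on I gamma & forall t, I t -> C (gamma t)] /\
    gamma 0 = p /\ derive1 gamma 0 = X.

(* Vectors are rows; a (1,1)-tensor acts on the column of coordinates. *)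
Definition principal_direction (S : 'M[R]_2) X : Prop :=
  X != 0 /\ exists mu : R, S *m X^T = mu *: X^T.

End Planar.

Section LineCongruence.
Variable R : realType.
Variables f xi : 'rV[R]_2 -> 'rV[R]_3.
Implicit Types (p q : 'rV[R]_2) (U : set 'rV[R]_2).

(* The rows of 'J f p are f_u(p) and f_v(p). *)
Definition immersion_at p : Prop := row_free ('J f p).
Definition transversal_at p : Prop := ~~ (xi p <= 'J f p)%MS.

Definition line_congruence U : Prop :=
  [/\ open U, smooth_on U f, smooth_on U xi,
      (forall p, U p -> immersion_at p) & forall p, U p -> transversal_at p].

Definition frame p : 'M[R]_3 := col_mx ('J f p) (xi p).

(* The coordinates of each row of w in the frame (f_u, f_v, xi). *)
Definition coords n p (w : 'M[R]_(n, 3)) : 'M[R]_(n, 2 + 1) :=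
  w *m invmx (frame p).

(* The rows of 'J xi p are D_{d_u} xi and D_{d_v} xi, so that the rows of the
   first block of coords p ('J xi p) are - S d_u and - S d_v: these are the
   columns of - S, whence the transpose. *)
Definition shape p : 'M[R]_2 := - (lsubmx (coords p ('J xi p)))^T.

Definition tau p : 'cV[R]_2 := rsubmx (coords p ('J xi p)).

(* D_{d_i} (f_* d_j) *)
Definition hess p (i j : 'I_2) : 'rV[R]_3 :=
  'D_(delta_mx 0 i) ('D_(delta_mx 0 j) f) p.

Definition connection p (i j : 'I_2) : 'rV[R]_2 := lsubmx (coords p (hess p i j)).

Definition second_form p : 'M[R]_2 :=
  \matrix_(i, j) rsubmx (coords p (hess p i j)) 0 0.

Definition equiaffine U : Prop :=
  forall p, U p -> tau p = 0 /\ second_form p \in unitmx.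

Definition discr p : R :=
  (shape p 0 0 - shape p 1 1) ^+ 2 + 4 * shape p 0 1 * shape p 1 0.

Definition discr_curve U : set 'rV[R]_2 := [set q | U q /\ discr q = 0].

(* The third column of the inverse frame; see conormalP. *)
Definition conormal p : 'rV[R]_3 :=
  (rsubmx (invmx (frame p) : 'M[R]_(3, 2 + 1)))^T.

Definition support_fun (Z : 'rV[R]_3) p : R := \sum_i conormal p 0 i * (Z - f p) 0 i.

Definition regular_discr_point U p : Prop :=
  forall X, principal_direction (shape p) X -> ~ tangent_to (discr_curve U) p X.

Lemma frame_unit p : immersion_at p -> transversal_at p -> frame p \in unitmx.
Proof.
move=> /eqP fI xT; rewrite -row_full_unit /row_full eqn_leq rank_leq_col /=.
have -> : \rank (frame p) = \rank ('J f p + xi p)%MS.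
  by symmetry; case: (addsmxE ('J f p) (xi p)).
rewrite -[X in (X < _)%N]fI; apply: rank_ltmx.
by rewrite ltmxE addsmxSl addsmx_sub submx_refl.
Qed.

Lemma coordsK n p (w : 'M[R]_(n, 3)) : frame p \in unitmx ->
  w = lsubmx (coords p w) *m 'J f p + rsubmx (coords p w) *m xi p.
Proof.
move=> Fu; rewrite -mul_row_col hsubmxK.
by rewrite -[RHS]/(w *m invmx (frame p) *m frame p) mulmxKV.
Qed.

Lemma weingarten p : frame p \in unitmx ->
  'J xi p = - (shape p)^T *m 'J f p + tau p *m xi p.
Proof. by move=> Fu; rewrite /shape linearN /= trmxK opprK -coordsK. Qed.

Lemma gauss p i j : frame p \in unitmx ->
  hess p i j = connection p i j *m 'J f p + second_form p i j *: xi p.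
Proof.
move=> Fu; rewrite [LHS](coordsK _ Fu) /connection mxE; congr (_ + _).
by rewrite {1}[rsubmx _]mx11_scalar mul_scalar_mx.
Qed.

Lemma conormalP p : frame p \in unitmx ->
  'J f p *m (conormal p)^T = 0 /\ xi p *m (conormal p)^T = 1%:M.
Proof.
move=> Fu; apply: eq_col_mx; rewrite -mul_col_mx trmxK.
pose F : 'M[R]_(2 + 1, 3) := frame p; pose G : 'M[R]_(3, 2 + 1) := invmx (frame p).
have FG : F *m G = block_mx 1%:M 0 0 1%:M.
  by rewrite -scalar_mx_block; exact: mulmxV.
suff : F *m rsubmx G = col_mx 0 1%:M by [].
have -> : F *m rsubmx G = rsubmx (F *m G).
  by rewrite -[in RHS](hsubmxK G) mul_mx_row row_mxKr.
by rewrite FG block_mxEh row_mxKr.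
Qed.

End LineCongruence.

(* Main.v *)
From HB Require Import structures.
Require Import Defs.
From mathcomp Require Import ring lra.
Set Implicit Arguments.
Unset Strict Implicit.
Unset Printing Implicit Defensive.
Import Order.TTheory GRing.Theory Num.Theory.
Local Open Scope classical_set_scope.
Local Open Scope ring_scope.

(* Write [Z - f = alpha + rho xi] in the moving frame, [alpha] being tangential. The
   structure equations give [d rho = - h(., alpha)] and
   [D_v alpha = - v + rho S v - Gamma(v, alpha)]. At [p] one has [alpha = 0] and
   [rho = 1 / lambda], so with [N = S - lambda] (nilpotent, and nonzero since 0 is a
   regular value of [discr]) the Hessian of [rho] is [- h(., N .) / lambda], of rank one
   with kernel the principal direction [X], and the third derivative of [rho] along [X] is
   [- h(X, (D_X S) X) / lambda]. As [X (x) h(X, .)] is a nonzero multiple of [N] and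
   [D_X discr = 4 tr (N D_X S)], it vanishes iff [D_X discr] does, i.e., iff [X] is tangent
   to the discriminant curve (implicit function theorem).
   At a critical point with rank one Hessian, A_2 means that the third derivative along the
   kernel is nonzero. It is invariant under changes of coordinates. Conversely, taking
   [D_Y g] as second coordinate makes [D_y g] vanish on [y = 0], whence
   [g = c + x^3 a(x, y) + y^2 b(x, y)] with [a], [b] smooth and nonvanishing by division. *)

(** * Calculus of [Cn] functions *)

(** An A_2 point is defined by a normal form on a whole neighbourhood, so a condition on derivatives
    at [p] is matched with it only by constructing coordinates. The first coordinate is kept linear
    with kernel spanned by Y; the second coordinate lines are then parallel to Y, and the derivative
    along them is a multiple of ['D_Y g], which is itself the second coordinate y. Hence, in these
    coordinates, g splits into a constant, a part depending on x alone and a part vanishing to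
    second order on y = 0, and each division concerns one variable. The quotients must be smooth
    across the axis of division. Their derivatives are again quotients of the same kind, so
    differentiability of every such quotient gives smoothness, with no integral remainder. The
    symmetry of h(., N .), on which the proportionality of X (x) h(X, .) and N rests, is read off
    from the symmetry of the Hessian of [rho] at [p]. The factor 4 in D_X discr comes from discr =
    (tr S)^2 - 4 det S, whose differential where tr S = 2 lambda is 4 tr (N .). *)

Section Differentiability.
Variables (R : realType) (V W : normedModType R).
Implicit Types (f g : V -> W) (x v : V) (A : set V).

(** [df] is a bare function with linearity and continuity proved apart, so that a formula found by
    hand, such as the differential of an inverse map or of a quotient, can be proposed as the
    differential. *)
Lemma is_diff_eps f (df : V -> W) x : linear df -> continuous df ->
  (forall e, 0 < e -> \forall h \near (0 : V), `|f (h + x) - f x - df h| <= e * `|h|) ->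
  is_diff x f df.
Proof.
move=> df_lin df_cont Hf.
pose L : {linear V -> W} := HB.pack df (GRing.isLinear.Build _ _ _ _ df df_lin).
have Hexp : f \o shift x = cst (f x) + (L : V -> W) +o_ (0 : V) id.
  apply/eqaddoP => e e0; near=> h.
  have -> : (f \o shift x - (cst (f x) + (L : V -> W))) h = f (h + x) - f x - df h.
    by rewrite /= -[LHS]/(f (h + x) - (f x + df h)) opprD addrA.
  by near: h; apply: Hf.
have dE : 'd f x = df :> (V -> W) by rewrite (@diff_unique _ _ _ f L x df_cont Hexp).
apply: DiffDef => //; apply/diff_locallyP.
by rewrite dE; split.
Unshelve. all: by end_near. Qed.

Lemma diff_eps f x : differentiable f x ->
  forall e, 0 < e -> \forall h \near (0 : V), `|f (h + x) - f x - 'd f x h| <= e * `|h|.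
Proof.
move=> /diff_locally /eqaddoP H e e0.
have := H e e0; apply: filterS => h /=.
by rewrite -[X in `|X|]/(f (h + x) - (f x + 'd f x h)) opprD addrA.
Qed.

Lemma near_eq_is_diff f g x :
  (\near x, f x = g x) -> differentiable f x -> is_diff x g ('d f x).
Proof.
move=> fg df; apply: is_diff_eps.
- by move=> a u w; rewrite linearP.
- exact: diff_continuous.
move=> e e0; near=> h.
rewrite -(nbhs_singleton fg).
have <- : f (h + x) = g (h + x).
  near: h; move: fg; rewrite (near_shift 0) subr0 => H.
  by apply: filterS H => y.
by near: h; apply: diff_eps.
Unshelve. all: by end_near. Qed.

End Differentiability.

Section Cn_theory.
Variables (R : realType).
Implicit Types (V W : normedModType R).

Lemma Cn_sub n V W (A B : set V) (g : V -> W) : A `<=` B -> Cn n B g -> Cn n A g.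
Proof.
move=> AB; elim: n g => [|n IH] g /=; first by move=> H x /AB/H.
by move=> [dg Dg]; split=> [x /AB/dg//|v]; apply: IH.
Qed.

(** Openness of [A] makes a pointwise equality pass to all derivatives. The closure properties below
    therefore only have to compute one derivative at the points of [A]. *)
Lemma Cn_ext n V W (A : set V) (g g' : V -> W) : open A ->
  (forall x, A x -> g x = g' x) -> Cn n A g -> Cn n A g'.
Proof.
move=> oA; elim: n g g' => [|n IH] g g' gg' /=.
  move=> H x Ax.
  have Hx : g @ x --> g x := H x Ax.
  suff : g' @ x --> g' x by [].
  rewrite -gg' //; apply: cvg_trans Hx; apply: near_eq_cvg.
  by apply: filterS (open_nbhs_nbhs (conj oA Ax)) => y /gg'.
have near_gg' x : A x -> \near x, g x = g' x.
  by move=> Ax; apply: filterS (open_nbhs_nbhs (conj oA Ax)).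
move=> [dg Dg]; split=> [x Ax|v].
  by have := near_eq_is_diff (near_gg' x Ax) (dg x Ax) => -[].
by apply: IH (Dg v) => x Ax; apply: near_eq_derive; apply: near_gg'.
Qed.

Lemma CnS n V W (A : set V) (g : V -> W) : Cn n.+1 A g -> Cn n A g.
Proof.
elim: n g => [|n IH] g; first by move=> [dg _] x Ax; apply: differentiable_continuous; apply: dg.
by move=> [dg Dg]; split=> // v; apply: IH.
Qed.

Lemma Cn_diff n V W (A : set V) (g : V -> W) x : Cn n.+1 A g -> A x -> differentiable g x.
Proof. by case=> + _; apply. Qed.

Lemma Cn_derive n V W (A : set V) (g : V -> W) v : Cn n.+1 A g -> Cn n A ('D_v g).
Proof. by case=> _; apply. Qed.

Lemma Cn_cont n V W (A : set V) (g : V -> W) x : Cn n A g -> A x -> {for x, continuous g}.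
Proof. by case: n => [|n]; [apply | move=> /Cn_diff H /H /differentiable_continuous]. Qed.

Lemma Cn_cst n V W (A : set V) (w : W) : Cn n A (cst w).
Proof.
elim: n w => [|n IH] w /=; first by move=> x _; apply: cst_continuous.
split=> [x _|v]; first exact: differentiable_cst.
have -> : 'D_v (cst w : V -> W) = cst 0 by apply/funext => x; rewrite derive_cst.
exact: IH.
Qed.

Lemma CnD n V W (A : set V) (f g : V -> W) : open A ->
  Cn n A f -> Cn n A g -> Cn n A (fun x => f x + g x).
Proof.
move=> oA; elim: n f g => [|n IH] f g.
  by move=> Hf Hg x Ax; apply: continuousD; [apply: Hf | apply: Hg].
move=> [df Df] [dg Dg]; split=> [x Ax|v].
  by apply: differentiableD; [apply: df | apply: dg].
apply: Cn_ext (IH _ _ (Df v) (Dg v)) => // x Ax.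
by rewrite -[RHS]/('D_v (f + g) x) deriveD //; apply: diff_derivable; [apply: df | apply: dg].
Qed.

Lemma CnM n V (A : set V) (f g : V -> R) : open A ->
  Cn n A f -> Cn n A g -> Cn n A (fun x => f x * g x).
Proof.
move=> oA; elim: n f g => [|n IH] f g.
  by move=> Hf Hg x Ax; apply: continuousM; [apply: Hf | apply: Hg].
move=> Hf Hg; have [df Df] := Hf; have [dg Dg] := Hg; split=> [x Ax|v].
  by apply: differentiableM; [apply: df | apply: dg].
have := CnD oA (IH _ _ (CnS Hf) (Dg v)) (IH _ _ (CnS Hg) (Df v)).
apply: Cn_ext => // x Ax.
by rewrite -[RHS]/('D_v (f * g) x) deriveM //; apply: diff_derivable; [apply: df | apply: dg].
Qed.

Lemma CnZ n V W (A : set V) (k : R) (g : V -> W) : open A ->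
  Cn n A g -> Cn n A (fun x => k *: g x).
Proof.
move=> oA; elim: n g => [|n IH] g.
  by move=> Hg x Ax; apply: continuousZr; apply: Hg.
move=> [dg Dg]; split=> [x Ax|v]; first by apply: differentiableZ; apply: dg.
apply: Cn_ext (IH _ (Dg v)) => // x Ax.
by rewrite -[RHS]/('D_v (k *: g) x) deriveZ //; apply: diff_derivable; apply: dg.
Qed.

Lemma CnN n V W (A : set V) (g : V -> W) : open A ->
  Cn n A g -> Cn n A (fun x => - g x).
Proof. by move=> oA /(CnZ (-1) oA); apply: Cn_ext => // x _; rewrite scaleN1r. Qed.

Lemma CnB n V W (A : set V) (f g : V -> W) : open A ->
  Cn n A f -> Cn n A g -> Cn n A (fun x => f x - g x).
Proof. by move=> oA Hf /(CnN oA); apply: CnD. Qed.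

Lemma Cn_sum n V W (A : set V) (I : Type) (s : seq I) (P : pred I) (F : I -> V -> W) : open A ->
  (forall i, P i -> Cn n A (F i)) -> Cn n A (fun x => \sum_(i <- s | P i) F i x).
Proof.
move=> oA H; elim: s => [|i s IH].
  by apply: Cn_ext (Cn_cst n A 0) => // x _; rewrite big_nil.
have [Pi|nPi] := boolP (P i).
  by apply: Cn_ext (CnD oA (H i Pi) IH) => // x _; rewrite big_cons Pi.
by apply: Cn_ext IH => // x _; rewrite big_cons (negbTE nPi).
Qed.

Lemma Cn_prod n V (A : set V) (I : Type) (s : seq I) (P : pred I) (F : I -> V -> R) : open A ->
  (forall i, P i -> Cn n A (F i)) -> Cn n A (fun x => \prod_(i <- s | P i) F i x).
Proof.
move=> oA H; elim: s => [|i s IH].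
  by apply: Cn_ext (Cn_cst n A (1 : R)) => // x _; rewrite big_nil.
have [Pi|nPi] := boolP (P i).
  by apply: Cn_ext (CnM oA (H i Pi) IH) => // x _; rewrite big_cons Pi.
by apply: Cn_ext IH => // x _; rewrite big_cons (negbTE nPi).
Qed.

Lemma CnX n V (A : set V) (f : V -> R) k : open A ->
  Cn n A f -> Cn n A (fun x => f x ^+ k).
Proof.
move=> oA Hf; elim: k => [|k IH]; first exact: Cn_cst.
by apply: Cn_ext (CnM oA Hf IH) => // x _; rewrite exprS.
Qed.

Lemma CnV n V (A : set V) (f : V -> R) : open A -> (forall x, A x -> f x != 0) ->
  Cn n A f -> Cn n A (fun x => (f x)^-1).
Proof.
move=> oA f0; elim: n => [|n IH] Hf.
  by move=> x Ax; apply: continuousV; [apply: f0 | apply: Hf].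
have [df Df] := Hf; split=> [x Ax|v].
  exact: (@differentiableV R V f x (df x Ax) (f0 x Ax)).
have := CnN oA (CnM oA (CnX 2 oA (IH (CnS Hf))) (Df v)).
apply: Cn_ext => // x Ax.
by rewrite deriveV ?f0 // ?exprVn ?scaleNr //; apply: diff_derivable; apply: df.
Qed.

Lemma Cn_linear n V W (A : set V) (L : {linear V -> W}) : open A -> continuous L ->
  Cn n A L.
Proof.
move=> oA cL; case: n => [|n]; first by move=> x _; apply: cL.
split=> [x _|v]; first exact: linear_differentiable.
apply: Cn_ext (Cn_cst n A (L v)) => // x _.
by rewrite deriveE ?diff_lin //; apply: linear_differentiable.
Qed.

Lemma derive_coord V m (g : V -> 'rV[R]_m) x v i : differentiable g x ->
  'D_v (fun y => g y 0 i) x = 'D_v g x 0 i.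
Proof. by move=> dg; rewrite derive_mx ?mxE //; apply: diff_derivable. Qed.

Lemma diff_coord V m (g : V -> 'rV[R]_m) x i : differentiable g x ->
  differentiable (fun y => g y 0 i) x.
Proof.
move=> dg; apply: (@differentiable_comp _ _ _ _ g (fun w : 'rV[R]_m => w 0 i)) => //.
exact: differentiable_coord.
Qed.

Lemma derive_rV_sum m W (g : 'rV[R]_m -> W) x w : differentiable g x ->
  'D_w g x = \sum_i w 0 i *: 'D_(delta_mx 0 i) g x.
Proof.
move=> dg; rewrite deriveE // {1}(row_sum_delta w) linear_sum.
by apply: eq_bigr => i _; rewrite linearZ deriveE.
Qed.

Lemma derive_comp (U : normedModType R) V W (phi : U -> V) (g : V -> W) x v :
  differentiable phi x -> differentiable g (phi x) ->
  'D_v (g \o phi) x = 'D_('D_v phi x) g (phi x).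
Proof.
move=> dp dg; rewrite !deriveE //; last exact: differentiable_comp.
by rewrite diff_comp.
Qed.

Lemma Cn_scale_cst n V W (A : set V) (a : V -> R) (w : W) : open A ->
  Cn n A a -> Cn n A (fun x => a x *: w).
Proof.
move=> oA; elim: n a => [|n IH] a.
  by move=> Ha x Ax; apply: continuousZl; apply: Ha.
move=> [da Da]; split=> [x Ax|v].
  by apply: differentiableZl; apply: da.
apply: Cn_ext (IH _ (Da v)) => // x Ax.
rewrite [RHS]deriveE; last by apply: differentiableZl; apply: da.
by rewrite (diffZl _ (da x Ax)) deriveE //; apply: da.
Qed.

Lemma Cn_coord n V m (A : set V) (g : V -> 'rV[R]_m) i : open A ->
  Cn n A g -> Cn n A (fun x => g x 0 i).
Proof.
move=> oA; elim: n g => [|n IH] g.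
  move=> Hg x Ax; apply: (@continuous_comp _ _ _ g (fun w : 'rV[R]_m => w 0 i)).
    exact: Hg.
  exact: coord_continuous.
move=> [dg Dg]; split=> [x Ax|v]; first by apply: diff_coord; apply: dg.
by apply: Cn_ext (IH _ (Dg v)) => // x Ax; rewrite derive_coord //; apply: dg.
Qed.

Lemma Cn_rV n V m (A : set V) (g : V -> 'rV[R]_m) : open A ->
  (forall i, Cn n A (fun x => g x 0 i)) -> Cn n A g.
Proof.
move=> oA Hg.
have H i : true -> Cn n A (fun x => g x 0 i *: (delta_mx 0 i : 'rV[R]_m)).
  by move=> _; apply: Cn_scale_cst.
by apply: Cn_ext (Cn_sum (index_enum 'I_m) oA H) => // x _; rewrite -row_sum_delta.
Qed.

(** The chain rule differentiates [g] in the direction ['D_v phi x], which moves with x, whereas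
    [Cn] speaks of constant directions. Expanding it along the coordinate vectors gives a finite sum
    of products to which the induction applies. *)
Lemma Cn_comp n V m (A : set V) (B : set 'rV[R]_m) (phi : V -> 'rV[R]_m)
    (g : 'rV[R]_m -> R) : open A -> (forall x, A x -> B (phi x)) ->
  Cn n A phi -> Cn n B g -> Cn n A (fun x => g (phi x)).
Proof.
move=> oA AB; elim: n g => [|n IH] g Hphi Hg.
  by move=> x Ax; apply: (@continuous_comp _ _ _ phi g); [apply: Hphi | apply/Hg/AB].
have [dphi Dphi] := Hphi; have [dg Dg] := Hg; split=> [x Ax|v].
  by apply: (@differentiable_comp _ _ _ _ phi g); [apply: dphi | apply/dg/AB].
have H (i : 'I_m) : true ->
    Cn n A (fun x => 'D_v phi x 0 i * 'D_(delta_mx 0 i) g (phi x)).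
  move=> _; apply: CnM => //; first exact: Cn_coord (Dphi v).
  by apply: IH (Dg _); apply: CnS.
apply: Cn_ext (Cn_sum (index_enum 'I_m) oA H) => // x Ax.
have [dphix dgx] := (dphi x Ax, dg _ (AB x Ax)).
by rewrite -[RHS]/('D_v (g \o phi) x) [RHS]derive_comp //= [RHS]derive_rV_sum.
Qed.

Lemma Cn_comp_rV n V m k (A : set V) (B : set 'rV[R]_m) (phi : V -> 'rV[R]_m)
    (g : 'rV[R]_m -> 'rV[R]_k) : open A -> open B -> (forall x, A x -> B (phi x)) ->
  Cn n A phi -> Cn n B g -> Cn n A (fun x => g (phi x)).
Proof.
move=> oA oB AB Hphi Hg; apply: Cn_rV => // i.
exact: (Cn_comp oA AB Hphi (Cn_coord i oB Hg)).
Qed.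

Lemma Cn_det n V m (A : set V) (M : V -> 'M[R]_m) : open A ->
  (forall i j, Cn n A (fun x => M x i j)) -> Cn n A (fun x => \det (M x)).
Proof.
move=> oA HM; apply: (Cn_sum _ oA) => s _; apply: CnM => //; first exact: Cn_cst.
by apply: Cn_prod.
Qed.

(** Cramer's rule: an entry of the inverse is a cofactor divided by the determinant, both polynomial
    in the entries. *)
Lemma Cn_invmx n V m (A : set V) (M : V -> 'M[R]_m) i j : open A ->
  (forall x, A x -> M x \in unitmx) ->
  (forall k l, Cn n A (fun x => M x k l)) -> Cn n A (fun x => invmx (M x) i j).
Proof.
move=> oA uM HM.
have Hadj : Cn n A (fun x => (\adj (M x)) i j).
  have : Cn n A (fun x => cofactor (M x) j i).
    apply: CnM => //; first exact: Cn_cst.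
    apply: Cn_det => // k l.
    by apply: Cn_ext (HM (lift j k) (lift i l)) => // x _; rewrite !mxE.
  by apply: Cn_ext => // x _; rewrite !mxE.
have det0 x : A x -> \det (M x) != 0 by move=> /uM; rewrite unitmxE unitfE.
apply: Cn_ext (CnM oA (CnV oA det0 (Cn_det oA HM)) Hadj) => // x Ax.
by rewrite /invmx uM // !mxE.
Qed.

(** Differentiation lowers the exponent by one, so the induction keeps [r] arbitrary. The cube and
    square roots of the normal form are instances. *)
Lemma Cn_powR n V (A : set V) (f : V -> R) r : open A -> (forall x, A x -> 0 < f x) ->
  Cn n A f -> Cn n A (fun x => f x `^ r).
Proof.
move=> oA f0.
have dpow (y s : R) : 0 < y -> differentiable (@powR R ^~ s) y.
  by move=> y0; apply/derivable1_diffP; case: (is_derive1_powR s y0).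
elim: n r => [|n IH] r Hf.
  move=> x Ax; apply: (@continuous_comp _ _ _ f (@powR R ^~ r)); first exact: Hf.
  by apply: differentiable_continuous; apply: dpow; apply: f0.
have [df Df] := Hf; split=> [x Ax|v].
  by apply: (@differentiable_comp _ _ _ _ f (@powR R ^~ r)); [apply: df | apply/dpow/f0].
have := CnM oA (CnZ r oA (IH (r - 1) (CnS Hf))) (Df v).
apply: Cn_ext => // x Ax.
have fx0 := f0 x Ax.
have [dfx dpx] := (df x Ax, dpow _ r fx0).
rewrite -[RHS]/('D_v ((@powR R ^~ r) \o f) x) [RHS]derive_comp //= [RHS]deriveE //.
have <- : 'D_v f x *: (1 : R) = 'D_v f x by exact: mulr1.
rewrite [RHS]linearZ -deriveE //.
have [_ ->] := is_derive1_powR r fx0.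
by rewrite [_ *: (1 : R)]mulr1 mulrC.
Qed.

End Cn_theory.
(** * Mean values, symmetry of second derivatives, inverse function theorem *)

Section MeanValue.
Variables (R : realType).
Implicit Types (V W : normedModType R).

Lemma is_derive_line V W (f : V -> W) (x v : V) (k t : R) :
  differentiable f (x + (t * k) *: v) ->
  is_derive t 1 (fun s => f (x + (s * k) *: v)) (k *: 'D_v f (x + (t * k) *: v)).
Proof.
move=> df.
pose phi (s : R) := x + (s * k) *: v.
have dphi : is_derive t 1 phi (k *: v).
  have -> : phi = cst x + (fun s : R => s *: (k *: v)).
    by apply/funext => s; rewrite /phi -[RHS]/(x + s *: (k *: v)) scalerA.
  have d1 : is_diff t (fun s : R => s *: (k *: v)) (fun s : R => s *: (k *: v)).
    exact: is_diff_scalel.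
  have d2 : is_derive t 1 (fun s : R => s *: (k *: v)) (k *: v).
    case: d1 => d1 E1; apply: DeriveDef; first exact: diff_derivable.
    by rewrite deriveE // E1 scale1r.
  by have := is_deriveD (is_derive_cst x t 1) d2; rewrite add0r.
have dphi' : differentiable phi t by apply/derivable1_diffP; case: dphi.
apply: DeriveDef.
  by apply/derivable1_diffP; apply: (@differentiable_comp _ _ _ _ phi f).
rewrite -[LHS]/('D_1 (f \o phi) t) derive_comp //.
case: dphi => _ ->.
by rewrite !deriveE // linearZ.
Qed.

Lemma MVT_line V (f : V -> R) (x v : V) (k : R) :
  (forall t : R, 0 <= t <= 1 -> differentiable f (x + (t * k) *: v)) ->
  exists2 t : R, 0 <= t <= 1 & f (x + k *: v) - f x = k * 'D_v f (x + (t * k) *: v).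
Proof.
move=> df.
pose g (s : R) := f (x + (s * k) *: v).
pose dg (s : R) := k * 'D_v f (x + (s * k) *: v).
have gD (s : R) : 0 <= s <= 1 -> is_derive s 1 g (dg s).
  by move=> s01; exact: (is_derive_line (df s s01)).
have [c] : exists2 c, c \in `]0, 1[ & g 1 - g 0 = dg c * (1 - 0).
  apply: MVT => //.
  - by move=> s; rewrite in_itv /= => /andP[s0 s1]; apply: gD; rewrite !ltW.
  - apply: derivable_within_continuous => s; rewrite in_itv /= => s01.
    by case: (gD s s01).
rewrite in_itv /= => /andP[c0 c1].
rewrite /g /dg mul1r mul0r scale0r addr0 subr0 mulr1 => Hc.
by exists c => //; rewrite !ltW.
Qed.

(** By two applications of the mean value theorem, the second difference of [f] over the
    parallelogram with sides k u and k v equals k^2 D_v D_u f at one of its points; with u and v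
    exchanged it equals k^2 D_u D_v f at another. Continuity of both mixed derivatives at x then
    excludes a gap e > 0 between them. *)
Lemma Clairaut V (A : set V) (f : V -> R) (x u v : V) : open A -> A x -> Cn 2 A f ->
  'D_v ('D_u f) x = 'D_u ('D_v f) x.
Proof.
move=> oA Ax Cf.
have key (a b y : V) (k : R) :
    (forall s t : R, 0 <= s <= 1 -> 0 <= t <= 1 -> A (y + (s * k) *: a + (t * k) *: b)) ->
    exists st : R * R, [/\ 0 <= st.1 <= 1, 0 <= st.2 <= 1 &
      f (y + k *: a + k *: b) - f (y + k *: a) - f (y + k *: b) + f y =
      k * (k * 'D_b ('D_a f) (y + (st.1 * k) *: a + (st.2 * k) *: b))].
  move=> HA.
  have I0 : 0 <= (0 : R) <= 1 by rewrite lexx ler01.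
  have I1 : 0 <= (1 : R) <= 1 by rewrite lexx ler01.
  pose g z := f (z + k *: b) - f z.
  have dfsh z : A (z + k *: b) -> is_diff z (fun z => f (z + k *: b)) ('d f (z + k *: b)).
    move=> Az; have df := Cn_diff Cf Az.
    pose sh (w : V) := w + k *: b.
    have dsh : is_diff z sh id.
      by apply: is_diff_eq; last exact: addr0.
    have : is_diff z (f \o sh) ('d f (z + k *: b) \o id).
      by apply: is_diff_comp; apply: differentiableP.
    by [].
  have Hg (t : R) : 0 <= t <= 1 -> differentiable g (y + (t * k) *: a).
    move=> t01.
    have A1 := HA t 1 t01 I1; have A0 := HA t 0 t01 I0.
    rewrite mul1r in A1; rewrite mul0r scale0r addr0 in A0.
    apply: (@differentiableB _ _ _ (fun z => f (z + k *: b)) f).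
      by case: (dfsh _ A1).
    exact: (Cn_diff Cf A0).
  have [t t01 Ht] := MVT_line Hg.
  have [A1 A0] := (HA t 1 t01 I1, HA t 0 t01 I0).
  rewrite mul1r in A1; rewrite mul0r scale0r addr0 in A0.
  have Dg : 'D_a g (y + (t * k) *: a) =
      'D_a f (y + (t * k) *: a + k *: b) - 'D_a f (y + (t * k) *: a).
    have [d1 E1] := dfsh _ A1; have d2 := Cn_diff Cf A0.
    rewrite [LHS](@deriveB _ _ _ (fun z => f (z + k *: b)) f); try exact: diff_derivable.
    by congr (_ - _); rewrite !deriveE ?E1 //; apply: (Cn_diff Cf A1).
  have [|s s01 Hs] := @MVT_line _ ('D_a f) (y + (t * k) *: a) b k.
    by move=> s s01; exact: (Cn_diff (Cn_derive a Cf) (HA t s t01 s01)).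
  exists (t, s); split=> //=.
  by rewrite -Hs -Dg -Ht /g; ring.
apply/eqP; rewrite -subr_eq0 -normr_eq0; apply/negP => /negP ne0.
move: ne0; move Ee : `|_| => e ne0.
have e0 : 0 < e by rewrite lt_neqAle eq_sym ne0 -Ee normr_ge0.
have e20 : 0 < e / 2 by rewrite divr_gt0.
have C1 : {for x, continuous ('D_v ('D_u f))} by exact: (Cn_cont (Cn_derive v (Cn_derive u Cf)) Ax).
have C2 : {for x, continuous ('D_u ('D_v f))} by exact: (Cn_cont (Cn_derive u (Cn_derive v Cf)) Ax).
have : \forall y \near x, [/\ A y, `|'D_v ('D_u f) x - 'D_v ('D_u f) y| < e / 2 &
    `|'D_u ('D_v f) x - 'D_u ('D_v f) y| < e / 2].
  have N0 : \forall y \near x, A y by exact: open_nbhs_nbhs.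
  have N1 : \forall y \near x, `|'D_v ('D_u f) x - 'D_v ('D_u f) y| < e / 2.
    by move/cvgrPdist_lt : C1 => /(_ _ e20).
  have N2 : \forall y \near x, `|'D_u ('D_v f) x - 'D_u ('D_v f) y| < e / 2.
    by move/cvgrPdist_lt : C2 => /(_ _ e20).
  by apply: filterS (filterI N0 (filterI N1 N2)) => y [? [? ?]]; split.
move=> /nbhs_ballP[d /= d0 Hd].
(* With k = d / (2 N) one has k (|u| + |v|) < d, so the parallelogram lies in the ball; the summand
   1 keeps N positive when u = v = 0. *)
pose N := `|u| + `|v| + 1.
have N0 : 0 < N by rewrite /N ltr_wpDl // addr_ge0.
pose k := d / (N * 2).
have k0 : 0 < k by rewrite divr_gt0 // mulr_gt0.
have Hball (s t : R) (a b : V) : `|a| + `|b| = `|u| + `|v| -> 0 <= s <= 1 -> 0 <= t <= 1 ->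
    ball x d (x + (s * k) *: a + (t * k) *: b).
  move=> ab /andP[s0 s1] /andP[t0 t1]; rewrite -ball_normE /= -addrA opprD addrA subrr add0r normrN.
  apply: le_lt_trans (ler_normD _ _) _.
  rewrite (normrZ (s * k)) (normrZ (t * k)) !(normrM _ k) (ger0_norm s0) (ger0_norm t0) (gtr0_norm k0).
  apply: (@le_lt_trans _ _ (k * `|a| + k * `|b|)).
    by apply: lerD; apply: ler_wpM2r => //; apply: ler_piMl => //; apply: ltW.
  rewrite -mulrDr ab /k mulrAC ltr_pdivrMr ?mulr_gt0 // ltr_pM2l //.
  by rewrite /N; have := normr_ge0 u; have := normr_ge0 v; lra.
have [|[s1 t1] /= [s101 t101 E1]] := key u v x k.
  by move=> s t s01 t01; have [] := Hd _ (Hball s t u v erefl s01 t01).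
have [|[s2 t2] /= [s201 t201 E2]] := key v u x k.
  by move=> s t s01 t01; have [] := Hd _ (Hball s t v u (addrC _ _) s01 t01).
have [_ H1 _] := Hd _ (Hball _ _ u v erefl s101 t101).
have [_ _ H2] := Hd _ (Hball _ _ v u (addrC _ _) s201 t201).
have EE : 'D_v ('D_u f) (x + (s1 * k) *: u + (t1 * k) *: v) =
          'D_u ('D_v f) (x + (s2 * k) *: v + (t2 * k) *: u).
  have kn0 : k != 0 by rewrite gt_eqF.
  have cancel (a b : R) : k * (k * a) = k * (k * b) -> a = b.
    by move=> H; exact: (mulfI kn0 (mulfI kn0 H)).
  have E12 : f (x + k *: u + k *: v) - f (x + k *: u) - f (x + k *: v) + f x =
      f (x + k *: v + k *: u) - f (x + k *: v) - f (x + k *: u) + f x.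
    by rewrite [x + k *: u + _]addrAC; move: (f _) (f _) (f _) (f _) => *; ring.
  exact: (cancel _ _ (etrans (esym E1) (etrans E12 E2))).
rewrite EE in H1.
have : e < e; last by rewrite ltxx.
rewrite -{1}Ee [ltRHS]splitr.
apply: le_lt_trans (ltrD H1 H2).
rewrite [X in _ <= _ + X]distrC.
apply: le_trans (ler_normD _ _).
by rewrite addrA subrK.
Qed.

End MeanValue.
(** Joins completeness to the normed module structure of matrices, as the Banach fixed point theorem
    requires. *)
HB.instance Definition _ (R : realType) (m n : nat) := Complete.on 'M[R]_(m, n).

Section Shift.
Variables (R : realType) (V W : normedModType R).

Lemma near_translate (x : V) (P : set V) :
  (\forall y \near x, P y) -> \forall h \near (0 : V), P (h + x).
Proof. by rewrite (near_shift 0) subr0; apply: filterS. Qed.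

Lemma near_increment (f : V -> W) (x : V) (P : set W) : {for x, continuous f} ->
  (\forall k \near (0 : W), P k) -> \forall h \near (0 : V), P (f (h + x) - f x).
Proof.
move=> fx; rewrite (near_shift (f x)) sub0r => HP.
exact: (near_translate (P := fun y => P (f y - f x)) (fx _ HP)).
Qed.

End Shift.

(** * Estimates for row vectors in the sup norm *)

Section RowVectors.
Variable R : realType.

Lemma norm_coord_le n (v : 'rV[R]_n) i : `|v 0 i| <= `|v|.
Proof.
rewrite [leRHS]/Num.Def.normr /= mx_normrE.
exact: (le_bigmax _ (fun ij : 'I_1 * 'I_n => `|v ij.1 ij.2|) (0, i)).
Qed.

Lemma norm_rV_le n (v : 'rV[R]_n) c : 0 <= c -> (forall i, `|v 0 i| <= c) -> `|v| <= c.
Proof.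
move=> c0 H; rewrite [leLHS]/Num.Def.normr /= mx_normrE.
by apply: bigmax_le => // -[i j] _ /=; rewrite (ord1 i).
Qed.

Lemma Cn_id n (V : normedModType R) (A : set V) : open A -> Cn n A (id : V -> V).
Proof.
move=> oA; have := @Cn_linear R n V V A idfun oA.
by apply=> x; exact: cvg_id.
Qed.

Lemma Cn_mulmx n (V : normedModType R) m k (A : set V) (g : V -> 'rV[R]_m)
    (M : 'M[R]_(m, k)) : open A -> Cn n A g -> Cn n A (fun x => g x *m M).
Proof.
move=> oA Hg; apply: Cn_rV => // i.
have H (j : 'I_m) : true -> Cn n A (fun x => g x 0 j * M j i).
  by move=> _; apply: CnM => //; [exact: Cn_coord | exact: Cn_cst].
by apply: Cn_ext (Cn_sum (index_enum 'I_m) oA H) => // x _; rewrite mxE.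
Qed.

Lemma continuous_mulmx m k (M : 'M[R]_(m, k)) : continuous (fun v : 'rV[R]_m => v *m M).
Proof.
move=> x; have := @Cn_mulmx 0 _ m k setT id M openT (@Cn_id 0 _ setT openT).
exact.
Qed.

Lemma is_diff_mulmx m k (M : 'M[R]_(m, k)) x :
  is_diff x (fun v : 'rV[R]_m => v *m M) (fun v => v *m M).
Proof.
have cM : continuous (mulmxr M : 'rV[R]_m -> 'rV[R]_k) by exact: continuous_mulmx.
by apply: DiffDef; [exact: (@linear_differentiable _ _ _ (mulmxr M) x cM)
                   | exact: (@diff_lin _ _ _ (mulmxr M) x cM)].
Qed.

Lemma derive_mulmx (V : normedModType R) m k (g : V -> 'rV[R]_m) (M : 'M[R]_(m, k)) x v :
  differentiable g x -> 'D_v (fun y => g y *m M) x = 'D_v g x *m M.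
Proof.
move=> dg; have [dM EM] := is_diff_mulmx M (g x).
rewrite -[LHS]/('D_v ((fun v : 'rV[R]_m => v *m M) \o g) x) derive_comp //.
by rewrite deriveE // EM.
Qed.

Lemma mulmx_bound m k (M : 'M[R]_(m, k)) :
  exists2 C, 0 < C & forall v : 'rV[R]_m, `|v *m M| <= C * `|v|.
Proof.
have cM : continuous (mulmxr M : 'rV[R]_m -> 'rV[R]_k) by exact: continuous_mulmx.
by have [C C0 H] := linear_lipschitz cM; exists C.
Qed.

Lemma jacobianE m k (g : 'rV[R]_m -> 'rV[R]_k) x i j : differentiable g x ->
  'J g x i j = 'D_(delta_mx 0 i) g x 0 j.
Proof. by move=> dg; rewrite deriveEjacobian // -rowE [RHS]mxE. Qed.

Lemma derive_bound m k (g : 'rV[R]_m -> 'rV[R]_k) x v c : 0 <= c -> differentiable g x ->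
  (forall i j, `|'D_(delta_mx 0 i) g x 0 j| <= c) -> `|'D_v g x| <= m%:R * c * `|v|.
Proof.
move=> c0 dg H; apply: norm_rV_le => [|j]; first by rewrite !mulr_ge0.
rewrite derive_rV_sum // summxE; apply: le_trans (ler_norm_sum _ _ _) _.
have -> : m%:R * c * `|v| = \sum_(i < m) `|v| * c.
  by rewrite sumr_const card_ord -[RHS]mulr_natl; ring.
by apply: ler_sum => i _; rewrite mxE normrM ler_pM // norm_coord_le.
Qed.

Lemma convex_ball m (p x y : 'rV[R]_m) r t : `|x - p| <= r -> `|y - p| <= r -> 0 <= t <= 1 ->
  `|y + t *: (x - y) - p| <= r.
Proof.
move=> xp yp /andP[t0 t1].
have -> : y + t *: (x - y) - p = (1 - t) *: (y - p) + t *: (x - p).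
  by rewrite scalerBl scale1r !scalerBr opprB addrACA; apply/rowP => i; rewrite !mxE; ring.
apply: le_trans (ler_normD _ _) _; rewrite !normrZ.
have t1' : 0 <= 1 - t by lra.
rewrite (ger0_norm t0) (ger0_norm t1').
have := ler_wpM2l t1' yp; have := ler_wpM2l t0 xp; lra.
Qed.

(** The mean value theorem is applied to each coordinate of [g], with its own intermediate point,
    and the sup norm collects the results. The factor m counts the partial derivatives in a
    directional one. *)
Lemma mean_value_ineq m k (g : 'rV[R]_m -> 'rV[R]_k) p r c : 0 <= c ->
  (forall z, `|z - p| <= r -> differentiable g z) ->
  (forall z i j, `|z - p| <= r -> `|'D_(delta_mx 0 i) g z 0 j| <= c) ->
  forall x y, `|x - p| <= r -> `|y - p| <= r -> `|g x - g y| <= m%:R * c * `|x - y|.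
Proof.
move=> c0 dg Hc x y xp yp; apply: norm_rV_le => [|j]; first by rewrite !mulr_ge0.
have seg (t : R) : 0 <= t <= 1 -> `|y + (t * 1) *: (x - y) - p| <= r.
  by rewrite mulr1; exact: convex_ball.
have [t t01] := @MVT_line R _ (fun z => g z 0 j) y (x - y) 1
  (fun t t01 => diff_coord j (dg _ (seg t t01))).
rewrite scale1r subrKC mul1r !mxE => ->.
rewrite derive_coord; last exact: dg (seg t t01).
apply: le_trans (norm_coord_le _ _) _; apply: derive_bound => //.
  exact: dg (seg t t01).
by move=> i l; apply: Hc (seg t t01).
Qed.

End RowVectors.

(** * Inverse function theorem by contraction *)

Section InverseFunction.
Variables (R : realType) (n : nat).
Implicit Types (p x v : 'rV[R]_n) (U : set 'rV[R]_n) (phi : 'rV[R]_n -> 'rV[R]_n).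

(* [E x = x - phi x *m M] with [M] the inverse of the Jacobian at [p] contracts near [p];
   solutions of [phi x = y] are the fixed points of [x |-> E x + y *m M]. *)
Theorem inverse_function U phi p : open U -> smooth_on U phi -> U p ->
  'J phi p \in unitmx ->
  exists A B psi, [/\ open A, open B, smooth_on A phi & smooth_on B psi] /\
    [/\ forall x, A x -> B (phi x), forall y, B y -> A (psi y),
        forall x, A x -> psi (phi x) = x & forall y, B y -> phi (psi y) = y] /\
    [/\ A p & A `<=` U].
Proof.
move=> oU sphi Up Ju; pose M := invmx ('J phi p).
have dphi x : U x -> differentiable phi x by exact: (Cn_diff (sphi 1%N)).
pose E (x : 'rV[R]_n) : 'rV[R]_n := x - phi x *m M.
have sE : smooth_on U E.
  by move=> k; apply: CnB => //; [exact: Cn_id | exact: Cn_mulmx].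
have dE x : U x -> differentiable E x by exact: (Cn_diff (sE 1%N)).
have DE x v : U x -> 'D_v E x = v - 'D_v phi x *m M.
  move=> Ux; rewrite -(derive_mulmx M v (dphi x Ux)).
  have dphiM : differentiable (fun y => phi y *m M) x.
    exact: (Cn_diff (Cn_mulmx M oU (sphi 1%N)) Ux).
  rewrite -[LHS]/('D_v (id - (fun y => phi y *m M)) x) deriveB ?derive_id //.
  exact: diff_derivable.
have DEp v : 'D_v E p = 0.
  by rewrite DE // deriveEjacobian ?mulmxK ?subrr //; exact: dphi.
(* The bound c on the partial derivatives of [E] makes [E] Lipschitz with constant n c <= 1/2; n + 1
   in place of n covers n = 0. *)
pose c : R := (n%:R + 1)^-1 / 2.
have c0 : 0 < c by rewrite divr_gt0 // invr_gt0 ltr_wpDl.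
have nc : n%:R * c <= 1 / 2.
  rewrite /c mulrA ler_pM2r // ler_pdivrMr ?ltr_wpDl // mul1r.
  by rewrite lerDl ler01.
have : \forall z \near p, forall ij : 'I_n * 'I_n, `|'D_(delta_mx 0 ij.1) E z 0 ij.2| <= c.
  apply: (@filter_forall _ _ (fun (ij : 'I_n * 'I_n) z => `|'D_(delta_mx 0 ij.1) E z 0 ij.2| <= c)
    (nbhs p) (nbhs_filter p)) => -[i j] /=.
  have C1 : {for p, continuous (fun z => 'D_(delta_mx 0 i) E z 0 j)}.
    exact: (Cn_cont (Cn_coord j oU (Cn_derive _ (sE 1%N))) Up).
  have : \forall z \near p, `|'D_(delta_mx 0 i) E p 0 j - 'D_(delta_mx 0 i) E z 0 j| < c.
    by move/cvgrPdist_lt : C1 => /(_ _ c0).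
  by apply: filterS => z; rewrite DEp mxE sub0r normrN => /ltW.
have nU : nbhs p U by exact: open_nbhs_nbhs.
move=> /(filterI nU) /nbhs_ballP[d /= d0 Hd].
pose r := d / 2; have r0 : 0 < r by rewrite divr_gt0.
have inU (z : 'rV[R]_n) : `|z - p| <= r -> U z /\ forall i j, `|'D_(delta_mx 0 i) E z 0 j| <= c.
  move=> zp; have [|Uz Hz] := Hd z.
    rewrite -ball_normE /= distrC; apply: le_lt_trans zp _.
    by rewrite /r ltr_pdivrMr // ltr_pMr // ltr1n.
  by split=> // i j; exact: (Hz (i, j)).
have c0' := ltW c0.
have E_lip (x y : 'rV[R]_n) : `|x - p| <= r -> `|y - p| <= r -> `|E x - E y| <= 1 / 2 * `|x - y|.
  move=> xr yr; apply: le_trans (mean_value_ineq c0' _ _ xr yr) _.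
  - by move=> z /inU[/dE].
  - by move=> z i j /inU[].
  - exact: ler_wpM2r.
have DE_le x v : `|x - p| <= r -> `|'D_v E x| <= 1 / 2 * `|v|.
  move=> /inU[Ux Hx]; apply: le_trans (derive_bound v c0' (dE x Ux) Hx) _.
  exact: ler_wpM2r.
(* Used with a = |x - y|: the half coming from [E] is absorbed, leaving |x - y| <= 2 |(phi x - phi
   y) M|. Both injectivity of [phi] and the Lipschitz bound for its inverse follow. *)
have half_le (a b : R) : 0 <= a -> a <= 1 / 2 * a + b -> a <= 2 * b by move=> *; lra.
have pr : `|p - p| <= r by rewrite subrr normr0 ltW.
have EB (x y : 'rV[R]_n) : x - y = E x - E y + (phi x - phi y) *m M.
  rewrite /E mulmxBl; move: (phi x *m M) (phi y *m M) => a b.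
  by apply/rowP => i; rewrite !mxE; ring.
have phi_inj (x y : 'rV[R]_n) : `|x - p| <= r -> `|y - p| <= r -> phi x = phi y -> x = y.
  move=> xr yr xy; apply/eqP; rewrite -subr_eq0 -normr_le0.
  rewrite -(mulr0 2); apply: half_le => //.
  by rewrite {1}EB xy subrr mul0mx !addr0 E_lip.
have Mu : M \in unitmx by rewrite unitmx_inv.
(* If v is killed by the Jacobian at x, then D_v E = v there, and |v| <= |v| / 2 forces v = 0. *)
have J_unit x : `|x - p| <= r -> 'J phi x \in unitmx.
  move=> xr; have [Ux _] := inU x xr.
  rewrite -row_free_unit -kermx_eq0; apply/eqP/row_matrixP => i; rewrite row0.
  set v := row i _.
  have vJ : v *m 'J phi x = 0 by rewrite -row_mul mulmx_ker row0.
  have := DE_le x v xr; rewrite DE // deriveEjacobian ?vJ ?mul0mx ?subr0; last exact: dphi.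
  move=> H; apply/eqP; rewrite -normr_le0; have := normr_ge0 v; lra.
(* The radius r / 2 is what the contraction leaves free: for y in [B] the map x |-> E x + y M sends
   the closed r-ball into the open one, its displacement from p being at most r / 2 plus something
   below r / 2. *)
pose B := [set y : 'rV[R]_n | `|(y - phi p) *m M| < r / 2].
pose A := [set x : 'rV[R]_n | `|x - p| < r /\ B (phi x)].
have oB : open B.
  rewrite openE => y; rewrite /B /= => By.
  have C1 : {for y, continuous (fun y : 'rV[R]_n => (y - phi p) *m M)}.
    have := @Cn_mulmx R 0 _ _ _ setT (fun y : 'rV[R]_n => y - phi p) M openT.
    by apply=> //; apply: CnB openT _ _; [exact: Cn_id openT | exact: Cn_cst].
  have e0 : 0 < r / 2 - `|(y - phi p) *m M| by rewrite subr_gt0.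
  move/cvgrPdist_lt : C1 => /(_ _ e0); apply: filterS => z /=.
  have := ler_normB ((y - phi p) *m M) ((y - phi p) *m M - (z - phi p) *m M).
  by rewrite opprB addrC subrK; lra.
have oA : open A.
  rewrite openE => x [xr Bx].
  have Ux : U x by have [] := inU x (ltW xr).
  apply: filterI.
    have e0 : 0 < r - `|x - p| by rewrite subr_gt0.
    apply/nbhs_ballP; exists (r - `|x - p|) => // z; rewrite -ball_normE /= => xz.
    by have := ler_distD x z p; rewrite (distrC z x); lra.
  have Cphi : {for x, continuous phi} := Cn_cont (sphi 0%N) Ux.
  exact: (Cphi _ (open_nbhs_nbhs (conj oB Bx))).
have sol y : B y -> exists x, `|x - p| < r /\ phi x = y.
  move=> By; pose T (x : 'rV[R]_n) : 'rV[R]_n := E x + y *m M; pose D := [set x : 'rV[R]_n | `|x - p| <= r].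
  have TD x : D x -> `|T x - p| < r.
    move=> Dx; have -> : T x - p = E x - E p + (y - phi p) *m M.
      rewrite /T /E mulmxBl; move: (phi x *m M) (phi p *m M) (y *m M) => a b d'.
      by apply/rowP => i; rewrite !mxE; ring.
    apply: le_lt_trans (ler_normD _ _) _.
    by have := E_lip x p Dx pr; move: By Dx; rewrite /B /D /=; lra.
  have Tfun : set_fun D D T by move=> x /TD /ltW.
  pose Tf : {fun D >-> D} := HB.pack T (isFun.Build _ _ D D T Tfun).
  have [|||x Dx xT] := @banach_fixed_point R 'rV[R]_n D Tf.
  - have h0 : 0 <= (1 / 2 : R) by [].
    exists (NngNum h0); split => /=; first by lra.
    move=> [x z] /= [Dx Dz]; rewrite /T opprD addrACA subrr addr0.
    exact: E_lip.
  - have -> : D = (fun x : 'rV[R]_n => `|x - p|) @^-1` [set t : R | t <= r] by [].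
    apply: closed_comp; last exact: closed_le.
    move=> x _; apply: (@continuous_comp _ _ _ (fun x : 'rV[R]_n => x - p)
      (fun x : 'rV[R]_n => `|x|)); last exact: norm_continuous.
    by apply: continuousB; [exact: cvg_id | exact: cst_continuous].
  - by exists p.
  exists x; split; first by rewrite xT; exact: TD.
  apply/eqP; rewrite -subr_eq0; apply/eqP.
  have : (phi x - y) *m M = 0.
    have -> : (phi x - y) *m M = x - T x.
      rewrite /T /E mulmxBl; move: (phi x *m M) (y *m M) => a b.
      by apply/rowP => i; rewrite !mxE; ring.
    by rewrite -[T x]/(Tf x) -xT subrr.
  by move=> /(congr1 (mulmx^~ (invmx M))); rewrite mulmxK // mul0mx.
(* The default [p] is taken only where no preimage exists in the ball, hence never on [B]. *)
pose psi y := xget p [set x : 'rV[R]_n | `|x - p| < r /\ phi x = y].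
have psiP y : B y -> `|psi y - p| < r /\ phi (psi y) = y.
  by move=> /sol ex; exact: (@xgetPex _ p [set x : 'rV[R]_n | `|x - p| < r /\ phi x = y] ex).
have psi_lip (y y' : 'rV[R]_n) : B y -> B y' -> `|psi y - psi y'| <= 2 * `|(y - y') *m M|.
  move=> /psiP[xr xy] /psiP[xr' xy']; apply: half_le => //.
  rewrite {1}EB xy xy'; apply: le_trans (ler_normD _ _) _.
  by rewrite lerD2r; apply: E_lip; apply: ltW.
have [C C0 HC] := mulmx_bound M.
have psi_lip' (y y' : 'rV[R]_n) : B y -> B y' -> `|psi y - psi y'| <= (2 * C) * `|y - y'|.
  move=> By By'; apply: le_trans (psi_lip y y' By By') _.
  by rewrite -mulrA ler_pM2l.
have C20 : 0 < 2 * C by rewrite mulr_gt0.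
have psi_cont y : B y -> {for y, continuous psi}.
  move=> By; suff : psi @ y --> psi y by [].
  apply: (proj2 (@cvgrPdist_lt _ _ _ (nbhs y) (nbhs_filter y) psi (psi y))) => e e0.
  have nB : nbhs y B by exact: open_nbhs_nbhs.
  have nb : nbhs y (ball y (e / (2 * C))) by apply: nbhsx_ballx; rewrite divr_gt0.
  apply: filterS (filterI nB nb) => z [Bz].
  rewrite -ball_normE /= ltr_pdivlMr // mulrC; apply: le_lt_trans.
  exact: psi_lip'.
have psi_diff y : B y -> is_diff y psi (fun k => k *m invmx ('J phi (psi y))).
  move=> By; set L := invmx _; set x := psi y.
  have [xr xy] := psiP y By; have [Ux _] := inU x (ltW xr).
  have JL : 'J phi x \in unitmx by apply: J_unit; apply: ltW.
  apply: is_diff_eps.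
  - by move=> a u w; rewrite mulmxDl scalemxAl.
  - exact: continuous_mulmx.
  move=> e e0; have [CL CL0 HCL] := mulmx_bound L.
  have e1 : 0 < e / (CL * (2 * C)) by rewrite divr_gt0 // mulr_gt0.
  have nB : \forall k \near (0 : 'rV[R]_n), B (k + y).
    by apply: near_translate; exact: open_nbhs_nbhs.
  have Hd' := near_increment (psi_cont y By) (diff_eps (dphi x Ux) e1).
  apply: filterS (filterI nB Hd') => k [Bk] /=.
  have [xkr xky] := psiP (k + y) Bk.
  set h := psi (k + y) - x.
  have -> : h + x = psi (k + y) by rewrite subrK.
  rewrite xky xy addrK -deriveE ?deriveEjacobian; try exact: dphi.
  move=> Hk.
  (* The error of [psi] at y is, up to sign, the image by L of the error of [phi] at x for the
     increment h, and |h| <= 2 C |k|. *)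
  have -> : h - k *m L = - ((k - h *m 'J phi x) *m L).
    by rewrite mulmxBl mulmxK // opprB.
  rewrite normrN; apply: le_trans (HCL _) _.
  have hk : `|h| <= 2 * C * `|k|.
    by have := psi_lip' _ _ Bk By; rewrite addrK.
  apply: (@le_trans _ _ (CL * (e / (CL * (2 * C)) * (2 * C * `|k|)))).
    rewrite ler_pM2l //; apply: le_trans Hk _.
    by rewrite ler_pM2l.
  suff -> : CL * (e / (CL * (2 * C)) * (2 * C * `|k|)) = e * `|k| by [].
  by field; rewrite !gt_eqF.
have psi_in y : B y -> A (psi y).
  by move=> By; have [? E1] := psiP y By; split=> //; rewrite E1.
have AU : A `<=` U by move=> x [/ltW /inU[]].
exists A, B, psi; split; split=> //.
- by move=> k; apply: Cn_sub (sphi k).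
(* Bootstrap: the differential of [psi] at y is the inverse Jacobian of [phi] at [psi y], so it is
   as regular as [psi] itself. *)
- elim=> [|k IH]; first by move=> y; exact: psi_cont.
  split=> [y By|v]; first by case: (psi_diff y By).
  have HJ i j : Cn k U (fun z => 'J phi z i j).
    apply: Cn_ext (Cn_coord j oU (Cn_derive (delta_mx 0 i) (sphi k.+1))) => // z Uz.
    by rewrite jacobianE //; exact: dphi.
  have Hinv i j : Cn k B (fun y => invmx ('J phi (psi y)) i j).
    apply: (@Cn_invmx R k _ n B (fun y => 'J phi (psi y)) i j oB).
      by move=> y /psiP[/ltW yr _]; exact: J_unit.
    move=> i' j'; apply: (Cn_comp oB _ IH (HJ i' j')).
    by move=> y /psi_in /AU.
  have Hv : Cn k B (fun y => v *m invmx ('J phi (psi y))).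
    apply: Cn_rV => // i.
    have H (j : 'I_n) : true -> Cn k B (fun y => v 0 j * invmx ('J phi (psi y)) j i).
      by move=> _; apply: CnM => //; exact: Cn_cst.
    by apply: Cn_ext (Cn_sum (index_enum 'I_n) oB H) => // y _; rewrite mxE.
  apply: Cn_ext Hv => // y By.
  by have [d1 E1] := psi_diff y By; rewrite deriveE // E1.
- split; first by move=> x [].
  + exact: psi_in.
  + move=> x [xr Bx]; have [xr' E1] := psiP _ Bx.
    by apply: phi_inj => //; apply: ltW.
  + by move=> y /psiP[].
- split=> //; rewrite /A /B /= !subrr mul0mx !normr0; split=> //.
  by rewrite divr_gt0.
Qed.

End InverseFunction.
(** * Division by a power of a coordinate *)

Section Smooth.
Variable R : realType.
Implicit Types V W : normedModType R.

Lemma smooth_derive V W (A : set V) (g : V -> W) v : smooth_on A g -> smooth_on A ('D_v g).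
Proof. by move=> sg n; exact: Cn_derive (sg n.+1). Qed.

Lemma smooth_diff V W (A : set V) (g : V -> W) x : smooth_on A g -> A x -> differentiable g x.
Proof. by move=> sg; exact: Cn_diff (sg 1%N). Qed.

Lemma derive_ext V W (A : set V) (f g : V -> W) x v : open A ->
  (forall y, A y -> f y = g y) -> A x -> 'D_v f x = 'D_v g x.
Proof.
move=> oA fg Ax; apply: near_eq_derive.
by apply: filterS (open_nbhs_nbhs (conj oA Ax)) => y /fg.
Qed.

(** The derivatives at the base point enter as an arbitrary sequence [a], so that differentiating
    the polynomial amounts to shifting [a]. *)
Definition taylor_sum (k : nat) (a : nat -> R) (s : R) : R :=
  \sum_(i < k.+1) a i / i`!%:R * s ^+ i.

Lemma is_derive_taylor_sum k (a : nat -> R) (s : R) :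
  is_derive s 1 (taylor_sum k.+1 a) (taylor_sum k (fun i => a i.+1) s).
Proof.
pose P := \poly_(i < k.+2) (a i / i`!%:R).
have -> : taylor_sum k.+1 a = horner P.
  by apply/funext => x; rewrite /P horner_poly.
have -> : taylor_sum k (fun i => a i.+1) s = P^`().[s].
  have -> : P^`() = \poly_(i < k.+1) (a i.+1 / i`!%:R).
    apply/polyP => i; rewrite coef_deriv !coef_poly ltnS.
    case: ifP => _; last by rewrite mul0rn.
    rewrite -[LHS]mulr_natr factS natrM.
    have i0 : (i.+1%:R : R) != 0 by rewrite pnatr_eq0.
    have f0 : (i`!%:R : R) != 0 by rewrite pnatr_eq0 -lt0n fact_gt0.
    by move: (i.+1%:R : R) i0 (i`!%:R : R) f0 => x x0 y y0; field; rewrite ?x0 ?y0.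
  by rewrite horner_poly.
exact: is_derive_poly.
Qed.

End Smooth.

(** * Taylor expansion along one coordinate and smoothness of the quotients *)

Section DividedDifference.
Variables (R : realType) (n : nat) (j : 'I_n).
Implicit Types (q w v : 'rV[R]_n) (A : set 'rV[R]_n) (G : 'rV[R]_n -> R).

Local Notation e_j := (delta_mx 0 j : 'rV[R]_n).

Definition nderive k G : 'rV[R]_n -> R := iter k (fun g => 'D_e_j g) G.

Definition hyp_proj q : 'rV[R]_n := q - q 0 j *: e_j.

(** The set contains the segment from each of its points to the projection on the hyperplane q_j =
    0, where the Taylor expansions are based. Balls centred at 0 for the sup norm have this
    property. *)
Definition fibered A := forall q (t : R), A q -> 0 <= t <= 1 ->
  A (hyp_proj q + (t * q 0 j) *: e_j).

Definition vanishes A k G := forall q i, A q -> q 0 j = 0 -> (i < k)%N -> nderive i G q = 0.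

(* [G / q_j ^ k], extended to the hyperplane [q_j = 0] by its Taylor coefficient. *)
Definition quotient k G q : R :=
  if q 0 j == 0 then nderive k G q / k`!%:R else G q / q 0 j ^+ k.

Lemma nderive_smooth A G k : smooth_on A G -> smooth_on A (nderive k G).
Proof. by move=> sG; elim: k => //= k IH; exact: smooth_derive. Qed.

Lemma nderive_comm A G k v q : open A -> smooth_on A G -> A q ->
  'D_v (nderive k G) q = nderive k ('D_v G) q.
Proof.
move=> oA sG; elim: k q => //= k IH q Aq.
rewrite (Clairaut _ _ oA Aq (nderive_smooth k sG 2%N)).
exact: (derive_ext _ oA).
Qed.

Lemma hyp_proj_coord q : hyp_proj q 0 j = 0.
Proof. by rewrite !mxE !eqxx mulr1 subrr. Qed.

Lemma hyp_projK q : hyp_proj q + q 0 j *: e_j = q.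
Proof. exact: subrK. Qed.

Lemma hyp_proj_id q : q 0 j = 0 -> hyp_proj q = q.
Proof. by rewrite /hyp_proj => ->; rewrite scale0r subr0. Qed.

(** The remainder vanishes at 0 and its derivative is the remainder of one order less for
    ['D_e_j G]; the mean value theorem therefore gives an induction. Bounding by the oscillation
    [eps] of the last derivative yields an o(|y|^k) estimate from continuity alone. *)
Lemma taylor A G k q (y eps : R) : smooth_on A G ->
  (forall t : R, 0 <= t <= 1 -> A (q + (t * y) *: e_j)) ->
  (forall t : R, 0 <= t <= 1 ->
     `|nderive k G (q + (t * y) *: e_j) - nderive k G q| <= eps) ->
  `|G (q + y *: e_j) - taylor_sum k (fun i => nderive i G q) y| <= eps * `|y| ^+ k.
Proof.
elim: k G y => [|k IH] G y sG HA Heps.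
  rewrite /taylor_sum big_ord1 fact0 divr1 expr0 !mulr1.
  by have := Heps 1; rewrite mul1r lexx ler01; apply.
pose a i := nderive i G q.
have aE : (fun i => nderive i ('D_e_j G) q) = (fun i => a i.+1).
  by apply/funext => i; rewrite /a /nderive iterSr.
pose F (s : R) := G (q + (s * 1) *: e_j) - taylor_sum k.+1 a s.
have dF (t : R) : 0 <= t <= 1 -> is_derive (t * y) 1 F
    ('D_e_j G (q + (t * y) *: e_j) - taylor_sum k (fun i => a i.+1) (t * y)).
  move=> t01; have dG : differentiable G (q + (t * y * 1) *: e_j).
    by rewrite mulr1; apply: (smooth_diff sG); apply: HA.
  have H1 := is_derive_line dG; have H2 := is_derive_taylor_sum k a (t * y).
  by have := is_deriveB H1 H2; rewrite scale1r mulr1.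
have dF' (t : R) : 0 <= t <= 1 -> differentiable F (0 + (t * y) *: (1 : R)).
  by move=> /dF[d1 _]; rewrite add0r [_ *: _]mulr1; apply/derivable1_diffP.
have [t t01] := MVT_line dF'.
rewrite add0r [y *: _]mulr1 add0r [(t * y) *: _]mulr1.
have [_ ->] := dF t t01.
have -> : F 0 = 0.
  rewrite /F mul0r scale0r addr0 /taylor_sum big_ord_recl /= expr0 fact0 divr1 mulr1.
  rewrite big1 ?addr0 ?subrr // => i _.
  by rewrite expr0n /= mulr0.
rewrite subr0 /F mulr1 => ->.
rewrite normrM exprS mulrCA ler_wpM2l // -aE.
have [t0 t1] := andP t01.
have sub (s : R) : 0 <= s <= 1 -> 0 <= s * t <= 1.
  by move=> /andP[s0 s1]; rewrite mulr_ge0 //= mulr_ile1.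
apply: le_trans (IH _ (t * y) (smooth_derive _ sG) _ _) _.
- by move=> s s01; rewrite mulrA; apply: HA; exact: sub.
- move=> s s01; rewrite mulrA.
  by have := Heps (s * t) (sub s s01); rewrite /nderive !iterSr.
have eps0 : 0 <= eps.
  by apply: le_trans (Heps 0 _) => //; rewrite lexx ler01.
rewrite ler_wpM2l // lerXn2r ?nnegrE // normrM (ger0_norm t0).
exact: ler_piMl.
Qed.

(** Expand [G] to order k + 1 at the projection of w and divide by the k-th power of w_j: the terms
    below k vanish, and the two remaining ones form an affine function of w_j. *)
Lemma quotient_taylor A G k w eps : smooth_on A G -> fibered A -> vanishes A k G -> A w ->
  (forall t : R, 0 <= t <= 1 ->
    `|nderive k.+1 G (hyp_proj w + (t * w 0 j) *: e_j) - nderive k.+1 G (hyp_proj w)| <= eps) ->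
  `|quotient k G w - nderive k G (hyp_proj w) / k`!%:R
    - w 0 j * (nderive k.+1 G (hyp_proj w) / k.+1`!%:R)| <= eps * `|w 0 j|.
Proof.
move=> sG fA vG Aw Heps; have [w0|w0] := eqVneq (w 0 j) 0.
  by rewrite /quotient w0 eqxx hyp_proj_id // subrr sub0r mul0r oppr0 normr0 mulr0.
have Apw : A (hyp_proj w).
  have := fA w 0 Aw; rewrite mul0r scale0r addr0 lexx ler01; exact.
have HA (t : R) : 0 <= t <= 1 -> A (hyp_proj w + (t * w 0 j) *: e_j) by exact: fA.
have := taylor sG HA Heps; rewrite hyp_projK /taylor_sum.
rewrite big_ord_recr big_ord_recr /= big1 ?add0r => [|i _]; last first.
  by rewrite (vG _ _ Apw (hyp_proj_coord w) (ltn_ord i)) !mul0r.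
rewrite /quotient (negbTE w0) => H.
have wk0 : 0 < `|w 0 j| ^+ k by rewrite exprn_gt0 // normr_gt0.
rewrite -(ler_pM2l wk0) -normrX -normrM normrX.
apply: le_trans (_ : _ <= eps * `|w 0 j| ^+ k.+1) _; last by rewrite exprS; lra.
apply: le_trans H; rewrite le_eqVlt; apply/orP; left; apply/eqP; congr (`|_|).
have k0 : (k`!%:R : R) != 0 by rewrite pnatr_eq0 -lt0n fact_gt0.
have k10 : (k.+1`!%:R : R) != 0 by rewrite pnatr_eq0 -lt0n fact_gt0.
by rewrite exprS; field; rewrite k0 k10 expf_neq0.
Qed.

Lemma hyp_proj_lin q v : hyp_proj (v + q) = hyp_proj v + hyp_proj q.
Proof. by rewrite /hyp_proj mxE scalerDl opprD addrACA. Qed.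

Lemma hyp_proj_le v : `|hyp_proj v| <= `|v|.
Proof.
apply: norm_rV_le => // i; rewrite !mxE eqxx /=.
have [->|ij] := eqVneq i j; first by rewrite mulr1 subrr normr0.
by rewrite mulr0 subr0 norm_coord_le.
Qed.

Lemma segment_le v (t : R) : 0 <= t <= 1 -> `|hyp_proj v + (t * v 0 j) *: e_j| <= `|v|.
Proof.
move=> /andP[t0 t1]; apply: norm_rV_le => // i; rewrite !mxE eqxx /=.
have [->|ij] := eqVneq i j; last by rewrite !mulr0 subr0 addr0 norm_coord_le.
rewrite !mulr1 subrr add0r normrM (ger0_norm t0).
by apply: le_trans (norm_coord_le v j); exact: ler_piMl.
Qed.

(** Moving along the hyperplane differentiates the k-th Taylor coefficient; moving across it has the
    (k + 1)-th coefficient as slope. Nearby points are compared with the coefficients at their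
    projections, which accounts for the two terms. *)
Lemma quotient_is_diff A G k q : open A -> smooth_on A G -> fibered A -> vanishes A k G ->
  A q -> q 0 j = 0 ->
  is_diff q (quotient k G) (fun v => 'D_(hyp_proj v) (nderive k G) q / k`!%:R
    + v 0 j * (nderive k.+1 G q / k.+1`!%:R)).
Proof.
move=> oA sG fA vG Aq q0.
have da := smooth_diff (nderive_smooth k sG) Aq.
have k0 : (k`!%:R : R) != 0 by rewrite pnatr_eq0 -lt0n fact_gt0.
pose df v := 'D_(hyp_proj v) (nderive k G) q / k`!%:R + v 0 j * (nderive k.+1 G q / k.+1`!%:R).
have df_lin : linear df.
  move=> c u v; rewrite /df.
  have -> : hyp_proj (c *: u + v) = c *: hyp_proj u + hyp_proj v.
    by rewrite /hyp_proj; apply/rowP => i; rewrite !mxE; ring.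
  rewrite !deriveE // !mxE.
  have -> : forall a b, 'd (nderive k G) q (c *: a + b) =
      c * 'd (nderive k G) q a + 'd (nderive k G) q b by move=> a b; rewrite linearP.
  by rewrite -[c *: (_ + _)]/(c * (_ + _)); ring.
apply: (is_diff_eps df_lin).
  have -> : df = (fun v : 'rV[R]_n => (v *m (\col_i df (delta_mx 0 i))) 0 0).
    apply/funext => v; rewrite mxE.
    pose L : {linear 'rV[R]_n -> R} := HB.pack df (GRing.isLinear.Build _ _ _ _ df df_lin).
    rewrite -[LHS]/(L v) [in LHS](row_sum_delta v) linear_sum; apply: eq_bigr => i _.
    by rewrite linearZ mxE.
  move=> v; apply: (@continuous_comp _ _ _ (fun v : 'rV[R]_n => v *m _) (fun u : 'rV[R]_1 => u 0 0)).
    exact: continuous_mulmx.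
  exact: coord_continuous.
(* The errors add up to 4 e1 |h|: two from [Q1] and one each from [Q3] and [Q4]. *)
move=> eps eps0; pose e1 := eps / 5; have e10 : 0 < e1 by rewrite divr_gt0.
have e1k : 0 < e1 * k`!%:R by rewrite mulr_gt0 // ltr0n fact_gt0.
have := diff_eps da e1k => /nbhs_ballP[d1 /= d10 H1].
have bcont : {for q, continuous (nderive k.+1 G)} by exact: (Cn_cont (nderive_smooth k.+1 sG 0%N)).
have : \forall z \near q, `|nderive k.+1 G q - nderive k.+1 G z| < e1.
  by move/cvgrPdist_lt : bcont => /(_ _ e10).
move=> /nbhs_ballP[d2 /= d20 H2].
have nA : \forall h \near (0 : 'rV[R]_n), A (h + q).
  by apply: near_translate; exact: open_nbhs_nbhs.
have n1 : \forall h \near (0 : 'rV[R]_n), ball 0 d1 h by exact: nbhsx_ballx.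
have n2 : \forall h \near (0 : 'rV[R]_n), ball 0 d2 h by exact: nbhsx_ballx.
apply: filterS (filterI nA (filterI n1 n2)) => h [Ah []].
rewrite -!ball_normE /= !sub0r !normrN => hd1 hd2.
pose ph := hyp_proj h.
have pw : hyp_proj (h + q) = ph + q by rewrite hyp_proj_lin (hyp_proj_id q0).
have wj : (h + q) 0 j = h 0 j by rewrite mxE q0 addr0.
have small (t : R) : 0 <= t <= 1 ->
    `|nderive k.+1 G q - nderive k.+1 G (ph + q + (t * h 0 j) *: e_j)| < e1.
  move=> t01; apply: H2; rewrite -ball_normE /= addrAC opprD addrCA subrr addr0 normrN.
  exact: le_lt_trans (segment_le h t01) hd2.
have small0 : `|nderive k.+1 G q - nderive k.+1 G (ph + q)| < e1.
  by have := small 0; rewrite mul0r scale0r addr0 lexx ler01; apply.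
have Q1 : `|quotient k G (h + q) - nderive k G (ph + q) / k`!%:R
    - h 0 j * (nderive k.+1 G (ph + q) / k.+1`!%:R)| <= (e1 + e1) * `|h 0 j|.
  have := @quotient_taylor A G k (h + q) (e1 + e1) sG fA vG Ah; rewrite pw wj; apply=> t t01.
  have := small t t01; have := small0; rewrite distrC => s1 s2.
  apply: le_trans (ler_distD (nderive k.+1 G q) _ _) _.
  by rewrite [X in X + _]distrC; apply: lerD; apply: ltW => //; rewrite distrC.
have Q2 : `|nderive k G (ph + q) - nderive k G q - 'd (nderive k G) q ph| <= e1 * k`!%:R * `|h|.
  have : ball (0 : 'rV[R]_n) d1 ph.
    by rewrite -ball_normE /= sub0r normrN; apply: le_lt_trans (hyp_proj_le h) hd1.
  move=> /H1 /le_trans; apply; rewrite ler_pM2l //; exact: hyp_proj_le.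
rewrite -deriveE // in Q2.
have hj : `|h 0 j| <= `|h| by exact: norm_coord_le.
have qq : quotient k G q = nderive k G q / k`!%:R by rewrite /quotient q0 eqxx.
set a1 := nderive k G (ph + q) in Q1 Q2; set a0 := nderive k G q in Q2 qq.
set b1 := nderive k.+1 G (ph + q) in Q1 small0; set b0 := nderive k.+1 G q in small0.
have -> : quotient k G (h + q) - quotient k G q - df h =
   (quotient k G (h + q) - a1 / k`!%:R - h 0 j * (b1 / k.+1`!%:R))
   + (a1 - a0 - 'D_ph (nderive k G) q) / k`!%:R + - (h 0 j * ((b0 - b1) / k.+1`!%:R)).
  by rewrite qq /df -/ph -/b0; ring.
have Q3 : `|(a1 - a0 - 'D_ph (nderive k G) q) / k`!%:R| <= e1 * `|h|.
  rewrite normrM normfV (ger0_norm (ler0n _ _)) ler_pdivrMr ?ltr0n ?fact_gt0 //.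
  by rewrite mulrAC.
have Q4 : `|h 0 j * ((b0 - b1) / k.+1`!%:R)| <= `|h| * e1.
  rewrite normrM ler_pM // normrM normfV (ger0_norm (ler0n _ _)).
  rewrite ler_pdivrMr ?ltr0n ?fact_gt0 //; apply: le_trans (ltW small0) _.
  by apply: ler_peMr; [exact: ltW | rewrite ler1n fact_gt0].
apply: le_trans (ler_normD _ _) _; rewrite normrN.
apply: le_trans (lerD (ler_normD _ _) Q4) _.
apply: le_trans (lerD (lerD Q1 Q3) (lexx _)) _.
have : (e1 + e1) * `|h 0 j| <= (e1 + e1) * `|h| by rewrite ler_wpM2l // addr_ge0 // ltW.
have h0 := normr_ge0 h; rewrite /e1; nra.
Qed.

Lemma derive_proj q v : 'D_v (fun z : 'rV[R]_n => z 0 j) q = v 0 j.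
Proof. by rewrite (@derive_coord _ _ _ id) ?derive_id. Qed.

(* [D_j (G / q_j ^ k) = euler_diff k G / q_j ^ k.+1], so derivatives of quotients are
   again quotients. *)
Definition euler_diff k G q : R := q 0 j * 'D_e_j G q - k%:R * G q.

Lemma Cn_proj m A : open A -> Cn m A (fun q : 'rV[R]_n => q 0 j).
Proof. by move=> oA; apply: (@Cn_coord _ _ _ _ _ id) => //; exact: Cn_id. Qed.

Lemma euler_diff_smooth A G k : open A -> smooth_on A G -> smooth_on A (euler_diff k G).
Proof.
move=> oA sG m; apply: CnB => //; apply: CnM => //.
- exact: Cn_proj.
- exact: smooth_derive.
- exact: Cn_cst.
Qed.

Lemma derive_coord_lincomb (a b : 'rV[R]_n -> R) (c : R) q v :
  differentiable a q -> differentiable b q ->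
  'D_v (fun z : 'rV[R]_n => z 0 j * a z + c * b z) q =
  v 0 j * a q + q 0 j * 'D_v a q + c * 'D_v b q.
Proof.
move=> da db.
have dx : differentiable (fun z : 'rV[R]_n => z 0 j) q by apply: (@diff_coord _ _ _ id).
have dxa : differentiable (fun z : 'rV[R]_n => z 0 j * a z) q by exact: differentiableM.
have dcb : differentiable (fun z : 'rV[R]_n => c * b z) q by exact: differentiableZ.
have E := @deriveD _ _ _ (fun z : 'rV[R]_n => z 0 j * a z) (fun z => c * b z) q v
  (diff_derivable dxa) (diff_derivable dcb).
have H1 := @deriveM _ _ (fun z : 'rV[R]_n => z 0 j) a q v (diff_derivable dx) (diff_derivable da).
have H2 := @deriveZ _ _ _ b c q v (diff_derivable db).
rewrite [LHS]E [X in X + _]H1 [X in _ + X]H2 derive_proj [_ *: v 0 j]mulrC.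
by rewrite [X in X + _]addrC.
Qed.

Lemma nderive_euler A G k i q : open A -> smooth_on A G -> A q ->
  nderive i (euler_diff k G) q =
  q 0 j * nderive i.+1 G q + (i%:R - k%:R) * nderive i G q.
Proof.
move=> oA sG; elim: i q => [|i IH] q Aq; first by rewrite /euler_diff /= sub0r mulNr.
rewrite [LHS](derive_ext _ oA IH Aq).
rewrite derive_coord_lincomb; last 2 first.
- exact: (smooth_diff (nderive_smooth i.+1 sG) Aq).
- exact: (smooth_diff (nderive_smooth i sG) Aq).
have c1 : (e_j : 'rV[R]_n) 0 j = 1 by rewrite mxE !eqxx.
rewrite c1 mul1r -[i.+1%:R]natr1 /=.
by move: ('D_e_j ('D_e_j (nderive i G)) q) ('D_e_j (nderive i G) q) => x y; ring.
Qed.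

(** On the hyperplane the i-th derivative of [euler_diff k G] is (i - k) times that of [G]: orders
    below k are inherited, and order k is killed by the factor. *)
Lemma vanishes_euler A G k : open A -> smooth_on A G -> vanishes A k G ->
  vanishes A k.+1 (euler_diff k G).
Proof.
move=> oA sG vG q i Aq q0; rewrite ltnS leq_eqVlt => /orP[/eqP->|ik];
  rewrite (nderive_euler _ _ oA sG Aq) q0 mul0r add0r; first by rewrite subrr mul0r.
by rewrite vG ?mulr0.
Qed.

Lemma derive_vanish A (f : _ -> R) q (u : 'rV[R]_n) : open A -> A q -> q 0 j = 0 -> u 0 j = 0 ->
  differentiable f q -> (forall z, A z -> z 0 j = 0 -> f z = 0) -> 'D_u f q = 0.
Proof.
move=> oA Aq q0 u0 df fz.
have df' : differentiable f (q + (0 * 1) *: u) by rewrite mul0r scale0r addr0.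
have [_] := is_derive_line df'; rewrite mul0r scale0r addr0 scale1r => <-.
rewrite -[RHS](derive_cst (0 : R) (0 : R) (1 : R)); apply: near_eq_derive.
have cu : {for 0, continuous (fun s : R => q + (s * 1) *: u)}.
  have -> : (fun s : R => q + (s * 1) *: u) = (fun s : R => q + s *: u).
    by apply/funext => s; rewrite mulr1.
  by apply: continuousD; [exact: cst_continuous|exact: scalel_continuous].
have nA : nbhs (q + (0 * 1) *: u) A.
  by rewrite mul0r scale0r addr0; exact: open_nbhs_nbhs.
have nS : \forall s \near (0 : R), A (q + (s * 1) *: u) := cu _ nA.
apply: filterS nS => s As.
by rewrite fz // !mxE q0 u0 mulr0 addr0.
Qed.

Lemma vanishes_derive A G k (u : 'rV[R]_n) : open A -> smooth_on A G -> u 0 j = 0 ->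
  vanishes A k G -> vanishes A k ('D_u G).
Proof.
move=> oA sG u0 vG q i Aq q0 ik; rewrite -(nderive_comm _ _ oA sG Aq).
apply: (derive_vanish oA Aq) => //; first exact: (smooth_diff (nderive_smooth i sG)).
by move=> z Az z0; apply: vG.
Qed.

Lemma derive_quotient A G k q v : open A -> smooth_on A G -> fibered A -> vanishes A k G ->
  A q -> differentiable (quotient k G) q /\
  'D_v (quotient k G) q = v 0 j * quotient k.+1 (euler_diff k G) q
                          + quotient k ('D_(hyp_proj v) G) q.
Proof.
move=> oA sG fA vG Aq; have [q0|q0] := eqVneq (q 0 j) 0.
  have [dQ EQ] := quotient_is_diff oA sG fA vG Aq q0.
  split=> //; rewrite deriveE // EQ /quotient q0 eqxx (nderive_comm _ _ oA sG Aq).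
  (* The factor supplied by [nderive_euler] at order k + 1 is (k + 1) - k = 1, so the slope across
     the hyperplane is exactly the value of the new quotient. *)
  by rewrite (nderive_euler _ _ oA sG Aq) q0 mul0r add0r -natr1 addrC [_ + 1]addrC addrK mul1r.
have Xc : {for q, continuous (fun z : 'rV[R]_n => z 0 j)} by exact: coord_continuous.
have near_ne : nbhs q (fun z : 'rV[R]_n => z 0 j != 0).
  exact: (Xc _ (open_nbhs_nbhs (conj (@open_neq _ 0) q0))).
have near_E : nbhs q (fun z : 'rV[R]_n => G z * (z 0 j ^+ k)^-1 = quotient k G z).
  by apply: filterS near_ne => z z0; rewrite /quotient (negbTE z0).
have dX : differentiable (fun z : 'rV[R]_n => z 0 j) q by apply: (@diff_coord _ _ _ id).
have dG := smooth_diff sG Aq.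
have Xk0 : q 0 j ^+ k != 0 by rewrite expf_neq0.
have dXk : differentiable (fun z : 'rV[R]_n => z 0 j ^+ k) q.
  exact: (Cn_diff (CnX k openT (Cn_proj 1 openT))).
have dXkV : differentiable (fun z : 'rV[R]_n => (z 0 j ^+ k)^-1) q.
  exact: (@differentiableV _ _ (fun z : 'rV[R]_n => z 0 j ^+ k)).
have dP : differentiable (fun z => G z * (z 0 j ^+ k)^-1) q by exact: differentiableM.
split; first by have [] := near_eq_is_diff near_E dP.
rewrite -(near_eq_derive v near_E).
rewrite -[LHS]/('D_v (G * (fun z : 'rV[R]_n => (z 0 j ^+ k)^-1)) q).
rewrite deriveM; [|exact: diff_derivable|exact: diff_derivable].
rewrite (@deriveV _ _ (fun z : 'rV[R]_n => z 0 j ^+ k)) //; last exact: diff_derivable.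
have -> : (fun z : 'rV[R]_n => z 0 j ^+ k) = (fun z : 'rV[R]_n => z 0 j) ^+ k.
  by apply/funext => z; elim: (k) => [|m IH]; rewrite ?expr0 // !exprS IH.
rewrite deriveX; last exact: diff_derivable.
rewrite derive_proj /quotient (negbTE q0) /euler_diff.
have -> : 'D_v G q = v 0 j * 'D_e_j G q + 'D_(hyp_proj v) G q.
  by rewrite !deriveE // -[in LHS](hyp_projK v) linearD linearZ addrC.
(* For k = 0 the exponent [k.-1] is truncated, but the factor k vanishes as well. *)
have kE : k%:R * q 0 j ^+ k.-1 * q 0 j = k%:R * q 0 j ^+ k.
  by case: (k) => [|m]; rewrite ?mul0r // -mulrA -exprSr.
have {kE} -> : k%:R * q 0 j ^+ k.-1 = k%:R * q 0 j ^+ k / q 0 j.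
  by rewrite -kE mulfK.
have sE (x y : R) : x *: y = x * y by [].
rewrite !sE (exprS (q 0 j)); move: (q 0 j ^+ k) Xk0 => X X0.
move: ('D_e_j G q) ('D_(hyp_proj v) G q) (G q) (q 0 j) q0 (v 0 j) => a b c d d0 e.
by field; rewrite ?X0 ?d0.
Qed.

(** The derivative of a quotient of order k involves one of order k + 1 with another numerator, so
    the induction on m runs over all k and G at once. *)
Theorem quotient_Cn A G k m : open A -> smooth_on A G -> fibered A -> vanishes A k G ->
  Cn m A (quotient k G).
Proof.
move=> oA + fA; elim: m k G => [|m IH] k G sG vG.
  move=> q Aq; apply: differentiable_continuous.
  by have [] := derive_quotient 0 oA sG fA vG Aq.
split=> [q Aq|v]; first by have [] := derive_quotient 0 oA sG fA vG Aq.
have H1 := IH k.+1 _ (euler_diff_smooth k oA sG) (vanishes_euler oA sG vG).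
have H2 := IH k _ (smooth_derive (hyp_proj v) sG)
  (vanishes_derive oA sG (hyp_proj_coord v) vG).
apply: Cn_ext (CnD oA (CnM oA (Cn_cst m A (v 0 j)) H1) H2) => // q Aq.
by have [_ ->] := derive_quotient v oA sG fA vG Aq.
Qed.

End DividedDifference.
(** * Normal form of A_2 points *)

Section ChainRule.
Variables (R : realType) (n : nat) (V : normedModType R).
Variables (A : set V) (U : set 'rV[R]_n) (psi : V -> 'rV[R]_n).
Implicit Types (g : 'rV[R]_n -> R) (a b : V -> R) (v w y : V).

Lemma derive_prod_vanish a b y w : differentiable a y -> differentiable b y ->
  a y = 0 -> b y = 0 -> 'D_w (fun z => a z * b z) y = 0.
Proof.
move=> da db a0 b0; rewrite -[LHS]/('D_w (a * b) y) deriveM; try exact: diff_derivable.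
by rewrite a0 b0 !scale0r addr0.
Qed.

Lemma derive2_prod_vanish a b y v : open A -> A y -> smooth_on A a -> smooth_on A b ->
  a y = 0 -> b y = 0 -> 'D_v b y = 0 -> 'D_v ('D_v (fun z => a z * b z)) y = 0.
Proof.
move=> oA Ay sa sb a0 b0 db0.
have dE z : A z -> 'D_v (fun z => a z * b z) z = a z * 'D_v b z + b z * 'D_v a z.
  move=> Az; rewrite -[LHS]/('D_v (a * b) z) deriveM //; apply: diff_derivable.
    exact: (smooth_diff sa).
  exact: (smooth_diff sb).
rewrite (derive_ext v oA dE Ay).
have dda := smooth_diff (smooth_derive v sa) Ay; have ddb := smooth_diff (smooth_derive v sb) Ay.
have da := smooth_diff sa Ay; have db := smooth_diff sb Ay.
rewrite -[LHS]/('D_v (a * 'D_v b + b * 'D_v a) y) deriveD; last 2 first.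
- by apply: derivableM; exact: diff_derivable.
- by apply: derivableM; exact: diff_derivable.
rewrite -[X in X + _]/('D_v (fun z => a z * 'D_v b z) y) derive_prod_vanish // add0r.
rewrite deriveM; try exact: diff_derivable.
by rewrite b0 db0 scale0r scaler0 addr0.
Qed.

Hypotheses (oA : open A) (oU : open U) (spsi : smooth_on A psi) (AU : forall y, A y -> U (psi y)).

Lemma smooth_comp g : smooth_on U g -> smooth_on A (fun z => g (psi z)).
Proof. by move=> sg k; apply: Cn_comp AU (spsi k) (sg k). Qed.

Lemma derive_comp_at g y v : smooth_on U g -> A y ->
  'D_v (fun z => g (psi z)) y = 'D_('D_v psi y) g (psi y).
Proof.
move=> sg Ay; apply: derive_comp; first exact: (smooth_diff spsi).
by apply: (smooth_diff sg); exact: AU.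
Qed.

Let defect g y v i z := ('D_v psi z 0 i - 'D_v psi y 0 i) * 'D_(delta_mx 0 i) g (psi z).

(* Freezing the velocity at y costs a term vanishing to second order at y. *)
Let frozen g y v z : smooth_on U g -> A z ->
  'D_v (fun z => g (psi z)) z =
  ((fun z => 'D_('D_v psi y) g (psi z)) + \sum_(i < n) defect g y v i) z.
Proof.
move=> sg Az; have dg := smooth_diff sg (AU Az).
rewrite derive_comp_at // -[RHS]/(_ + _) fct_sumE (derive_rV_sum _ dg).
rewrite (derive_rV_sum ('D_v psi y) dg) -big_split /=; apply: eq_bigr => i _.
have split (x c d : R) : x * d = c * d + (x - c) * d by ring.
exact: split.
Qed.

Let sub_smooth y v i : smooth_on A (fun z => 'D_v psi z 0 i - 'D_v psi y 0 i).
Proof.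
move=> k; apply: CnB => //; last exact: Cn_cst.
exact: Cn_coord (smooth_derive v spsi k).
Qed.

Let partial_smooth g i : smooth_on U g -> smooth_on A (fun z => 'D_(delta_mx 0 i) g (psi z)).
Proof. by move=> sg; exact: (smooth_comp (smooth_derive _ sg)). Qed.

Let defect_smooth g y v i : smooth_on U g -> smooth_on A (defect g y v i).
Proof. by move=> sg k; apply: CnM => //; [exact: sub_smooth | exact: partial_smooth]. Qed.

Let main_smooth g u : smooth_on U g -> smooth_on A (fun z => 'D_u g (psi z)).
Proof. by move=> sg; exact: (smooth_comp (smooth_derive _ sg)). Qed.

(** Each defect is a product of two factors vanishing at y, one by the freezing and the other
    because [psi y] is critical. The second derivatives of [psi] therefore drop out. *)
Lemma hessian_comp g y v w : smooth_on U g -> A y -> (forall u, 'D_u g (psi y) = 0) ->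
  'D_w ('D_v (fun z => g (psi z))) y = 'D_('D_w psi y) ('D_('D_v psi y) g) (psi y).
Proof.
move=> sg Ay crit; rewrite (derive_ext w oA (fun z => @frozen g y v z sg) Ay).
have dd i : differentiable (defect g y v i) y.
  exact: (smooth_diff (@defect_smooth g y v i sg)).
rewrite deriveD; last 2 first.
- by apply: diff_derivable; exact: (smooth_diff (main_smooth ('D_v psi y) sg)).
- by apply: derivable_sum => i; exact: diff_derivable.
rewrite derive_sum => [|i]; last exact: diff_derivable.
rewrite big1 ?addr0 => [|i _].
  by apply: derive_comp_at => //; exact: smooth_derive.
apply: derive_prod_vanish; last 2 first.
- by rewrite subrr.
- exact: crit.
- exact: (smooth_diff (@sub_smooth y v i)).
- exact: (smooth_diff (partial_smooth i sg)).
Qed.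

(** Along a velocity u in the kernel of the Hessian, the factor D_i g of a defect vanishes at y
    together with its v-derivative, as D_u D_i g = D_i D_u g = 0; so the second derivative of the
    defect vanishes. The remaining term is a Hessian of ['D_u g], which is itself critical at
    [psi y]. *)
Lemma third_derivative_comp g y v : smooth_on U g -> A y -> (forall u, 'D_u g (psi y) = 0) ->
  (forall u, 'D_u ('D_('D_v psi y) g) (psi y) = 0) ->
  'D_v ('D_v ('D_v (fun z => g (psi z)))) y =
  'D_('D_v psi y) ('D_('D_v psi y) ('D_('D_v psi y) g)) (psi y).
Proof.
move=> sg Ay crit ker; set u := 'D_v psi y.
have dd i z : A z -> derivable (defect g y v i) z v.
  by move=> Az; apply: diff_derivable; exact: (smooth_diff (@defect_smooth g y v i sg)).
have D1 z : A z -> 'D_v ('D_v (fun z => g (psi z))) z =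
    ('D_v (fun z => 'D_u g (psi z)) + \sum_(i < n) 'D_v (defect g y v i)) z.
  move=> Az; rewrite (derive_ext v oA (fun z => @frozen g y v z sg) Az).
  rewrite deriveD; last 2 first.
  - by apply: diff_derivable; exact: (smooth_diff (main_smooth u sg)).
  - by apply: derivable_sum => i; exact: dd.
  rewrite derive_sum => [|i]; last exact: dd.
  by rewrite -[RHS]/(_ + _) fct_sumE.
rewrite (derive_ext v oA D1 Ay).
have ddd i : derivable ('D_v (defect g y v i)) y v.
  apply: diff_derivable.
  exact: (smooth_diff (smooth_derive v (@defect_smooth g y v i sg))).
rewrite deriveD; last 2 first.
- by apply: diff_derivable; exact: (smooth_diff (smooth_derive v (main_smooth u sg))).
- exact: derivable_sum.
rewrite derive_sum // big1 ?addr0 => [|i _].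
  by apply: (@hessian_comp ('D_u g)) => //; exact: smooth_derive.
apply: (@derive2_prod_vanish _ _ y v oA Ay (@sub_smooth y v i) (@partial_smooth g i sg)).
- exact: subrr.
- exact: crit.
- rewrite (derive_comp_at (g := 'D_(delta_mx 0 i) g)) //; last exact: smooth_derive.
  by rewrite (Clairaut _ _ oU (AU Ay) (sg 2%N)) ker.
Qed.

End ChainRule.

(** * Coordinates having a prescribed function as second coordinate *)

Section Straightening.
Variable R : realType.
Implicit Types (p q v : 'rV[R]_2) (B : 'M[R]_2) (U : set 'rV[R]_2).

Lemma sum_ord2 (V : nmodType) (F : 'I_2 -> V) : \sum_i F i = F 0 + F 1.
Proof.
rewrite !big_ord_recl big_ord0 addr0; congr (_ + F _).
exact: val_inj.
Qed.

Lemma ord2P (P : 'I_2 -> Prop) : P 0 -> P 1 -> forall i, P i.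
Proof.
move=> P0 P1 [[|[|//]] Hi].
  by have -> : Ordinal Hi = 0 by exact: val_inj.
by have -> : Ordinal Hi = 1 by exact: val_inj.
Qed.

Lemma rV2P (u v : 'rV[R]_2) : u 0 0 = v 0 0 -> u 0 1 = v 0 1 -> u = v.
Proof. by move=> H0 H1; apply/rowP; apply: ord2P. Qed.

Lemma basis2 B v : B \in unitmx ->
  v = (v *m invmx B) 0 0 *: row 0 B + (v *m invmx B) 0 1 *: row 1 B.
Proof. by move=> Bu; rewrite -(sum_ord2 (fun i => (v *m invmx B) 0 i *: row i B)) -mulmx_sum_row mulmxKV. Qed.

Lemma unitmx_inj n (M : 'M[R]_n) : (forall v : 'rV_n, v *m M = 0 -> v = 0) -> M \in unitmx.
Proof.
move=> H; rewrite -row_free_unit -kermx_eq0; apply/eqP/row_matrixP => i; rewrite row0.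
by apply: H; rewrite -row_mul mulmx_ker row0.
Qed.

Lemma derive_lin2 (V : normedModType R) (g : V -> R) x (a b : R) (u v : V) :
  differentiable g x -> 'D_(a *: u + b *: v) g x = a * 'D_u g x + b * 'D_v g x.
Proof. by move=> dg; rewrite !deriveE // linearD; congr (_ + _); exact: linearZ. Qed.

(** The first coordinate is affine and constant along [row 1 B], so the curves on which only the
    second coordinate w varies are parallel to [row 1 B]. *)
Definition straight B p (w : 'rV[R]_2 -> R) q : 'rV[R]_2 :=
  \row_(j < 2) (if j == 0 then ((q - p) *m invmx B) 0 0 else w q).

(** The Jacobian at p is invertible: a vector on which the first coordinate vanishes is a multiple
    of [row 1 B], along which w has nonzero derivative. The parallelism with [row 1 B] holds on all
    of [C], as the normal form requires. The lemma serves both there, with w a derivative of g, and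
    for level curves of w. *)
Lemma straightening U B p (w : 'rV[R]_2 -> R) : open U -> U p -> smooth_on U w ->
  B \in unitmx -> w p = 0 -> 'D_(row 0 B) w p = 0 -> 'D_(row 1 B) w p != 0 ->
  exists A C psi, diffeomorphism A C (straight B p w) psi /\
    [/\ A p, A `<=` U, C 0 & psi 0 = p] /\
    [/\ forall y, C y -> w (psi y) = y 0 1,
        'D_(delta_mx 0 0) psi 0 = row 0 B,
        forall y, C y -> 'D_(delta_mx 0 1) psi y =
          ('D_(delta_mx 0 1) psi y *m invmx B) 0 1 *: row 1 B &
        'D_('D_(delta_mx 0 1) psi 0) w p = 1].
Proof.
move=> oU Up sw Bu w0 wX wY.
pose phi := straight B p w.
have phi0 q : phi q 0 0 = ((q - p) *m invmx B) 0 0 by rewrite mxE.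
have phi1 q : phi q 0 1 = w q by rewrite mxE.
have sphi : smooth_on U phi.
  move=> k; apply: Cn_rV => //; apply: ord2P.
    have : Cn k U (fun q => ((q - p) *m invmx B) 0 0).
      apply: Cn_coord => //; apply: Cn_mulmx => //.
      by apply: CnB => //; [exact: Cn_id | exact: Cn_cst].
    by apply: Cn_ext => // q _; rewrite phi0.
  by apply: Cn_ext (sw k) => // q _; rewrite phi1.
have dphi q : U q -> differentiable phi q by move=> Uq; exact: (smooth_diff sphi).
have D0 q v : U q -> 'D_v phi q 0 0 = (v *m invmx B) 0 0.
  move=> Uq; rewrite -(derive_coord _ _ (dphi q Uq)).
  have -> : (fun y => phi y 0 0) = (fun y => ((y - p) *m invmx B) 0 0).
    by apply/funext => y; rewrite phi0.
  have ds : differentiable (fun y : 'rV[R]_2 => y - p) q by exact: differentiableB.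
  have dsm : differentiable (fun y : 'rV[R]_2 => (y - p) *m invmx B) q.
    apply: (@differentiable_comp _ _ _ _ (fun y : 'rV[R]_2 => y - p)
      (fun y : 'rV[R]_2 => y *m invmx B)) => //.
    by have [] := is_diff_mulmx (invmx B) (q - p).
  rewrite (derive_coord _ _ dsm) (derive_mulmx _ _ ds).
  rewrite -[X in (X *m _) _ _ = _]/('D_v (id - cst p) q) deriveB //.
  by rewrite derive_id derive_cst subr0.
have D1 q v : U q -> 'D_v phi q 0 1 = 'D_v w q.
  move=> Uq; rewrite -(derive_coord _ _ (dphi q Uq)).
  by have -> : (fun y => phi y 0 1) = w by apply/funext => y; rewrite phi1.
have dwp : differentiable w p by exact: (smooth_diff sw).
have Dw v : 'D_v w p = (v *m invmx B) 0 1 * 'D_(row 1 B) w p.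
  by rewrite {1}(basis2 v Bu) derive_lin2 // wX mulr0 add0r.
have phip : phi p = 0.
  by apply: rV2P; rewrite ?phi0 ?phi1 ?subrr ?mul0mx ?w0 !mxE.
have Ju : 'J phi p \in unitmx.
  apply: unitmx_inj => v; rewrite -deriveEjacobian; last exact: dphi.
  move=> Dv.
  have := D1 p v Up; rewrite Dv Dw [LHS]mxE => /esym/eqP.
  rewrite mulf_eq0 (negbTE wY) orbF => /eqP v1.
  have := D0 p v Up; rewrite Dv [LHS]mxE => /esym v0.
  by rewrite (basis2 v Bu) v0 v1 !scale0r addr0.
have [A [C [psi [[oA oC sA sC] [[AC CA psiK phiK] [Ap AU]]]]]] := inverse_function oU sphi Up Ju.
have C0 : C 0 by rewrite -phip; exact: AC.
have psi0 : psi 0 = p by rewrite -phip psiK.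
have chain y v : C y -> 'D_('D_v psi y) phi (psi y) = v.
  move=> Cy; rewrite -derive_comp; first last.
  - by apply: dphi; apply: AU; exact: CA.
  - exact: (smooth_diff sC).
  rewrite (@derive_ext _ _ _ C (phi \o psi) id y v oC) // derive_id //.
have c0 y v : C y -> ('D_v psi y *m invmx B) 0 0 = v 0 0.
  by move=> Cy; rewrite -(D0 (psi y)) ?chain //; apply: AU; exact: CA.
have c1 y v : C y -> 'D_('D_v psi y) w (psi y) = v 0 1.
  by move=> Cy; rewrite -(D1 (psi y)) ?chain //; apply: AU; exact: CA.
exists A, C, psi; split; first by split; split.
split; first by split.
split.
- by move=> y Cy; rewrite -phi1 phiK.
- rewrite (basis2 ('D_(delta_mx 0 0) psi 0) Bu) c0 // [X in X *: _]mxE /=.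
  have := c1 0 (delta_mx 0 0) C0; rewrite psi0 Dw [RHS]mxE /= => /eqP.
  by rewrite mulf_eq0 (negbTE wY) orbF => /eqP ->; rewrite scale0r addr0 scale1r.
- move=> y Cy; rewrite {1}(basis2 ('D_(delta_mx 0 1) psi y) Bu) c0 //.
  by rewrite mxE /= scale0r add0r.
- by have := c1 0 (delta_mx 0 1) C0; rewrite psi0 [X in _ = X]mxE.
Qed.

End Straightening.

(** * Reduction of a degenerate critical point to x^3 and y^2 *)

Section NormalForm.
Variable R : realType.
Implicit Types (p q v z : 'rV[R]_2) (B : 'M[R]_2) (U A C : set 'rV[R]_2).
Implicit Types (g : 'rV[R]_2 -> R) (j : 'I_2).

Local Notation e_ j := (delta_mx 0 j : 'rV[R]_2).

Lemma is_diff0 (V : normedModType R) (g : V -> R) (p : V) : differentiable g p ->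
  (forall v : V, 'D_v g p = 0) -> critical_point g p.
Proof.
by move=> dg H; apply: DiffDef => //; apply/funext => v; rewrite -deriveE // H.
Qed.

Lemma derive_subcst (V : normedModType R) (g : V -> R) (c : R) (v : V) :
  'D_v (fun x => g x - c) = 'D_v g.
Proof.
apply/funext => x; rewrite /derive.
suff -> : (fun h => h^-1 *: (((fun y => g y - c) \o shift x) (h *: v) - (g x - c))) =
  (fun h => h^-1 *: ((g \o shift x) (h *: v) - g x)) by [].
by apply/funext => h /=; rewrite opprB addrA subrK.
Qed.

Lemma diffeomorphism_comp A C A' C' phi psi phi' psi' :
  diffeomorphism A C phi psi -> diffeomorphism A' C' phi' psi' -> A' `<=` C ->
  diffeomorphism (A `&` phi @^-1` A') C' (phi' \o phi) (psi \o psi').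
Proof.
move=> [[oA oC sphi spsi] [AC CA phiK psiK]] [[oA' oC' sphi' spsi'] [AC' CA' phiK' psiK']] A'C.
have cphi x : A x -> {for x, continuous phi} by move=> Ax; exact: (Cn_cont (sphi 0%N)).
have oD : open (A `&` phi @^-1` A').
  rewrite openE => x [Ax A'x]; apply: filterI; first exact: open_nbhs_nbhs.
  exact: (cphi x Ax _ (open_nbhs_nbhs (conj oA' A'x))).
split; split=> //.
- move=> k; apply: (@Cn_comp_rV _ _ _ _ _ _ A') (sphi' k) => //; first by move=> x [].
  exact: Cn_sub (sphi k).
- move=> k; apply: (@Cn_comp_rV _ _ _ _ _ _ C) (spsi k) => //.
  by move=> y /CA' /A'C.
- by move=> x [_ A'x]; exact: AC'.
- move=> y Cy; have A'y := CA' y Cy; have Cy' := A'C _ A'y.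
  by split; [exact: CA | rewrite /preimage /= psiK].
- by move=> x [Ax A'x] /=; rewrite phiK' // phiK.
- by move=> y Cy /=; rewrite psiK ?psiK' //; apply: A'C; exact: CA'.
Qed.

Lemma quotientK j A G k q : vanishes j A k.+1 G -> A q ->
  G q = q 0 j ^+ k.+1 * quotient j k.+1 G q.
Proof.
move=> vG Aq; rewrite /quotient; have [q0|q0] := eqVneq (q 0 j) 0.
  by rewrite q0 expr0n mul0r; exact: (vG q 0%N).
by rewrite mulrC divfK // expf_neq0.
Qed.

Lemma ball0E (r : R) z : ball (0 : 'rV[R]_2) r z <-> `|z| < r.
Proof. by rewrite -ball_normE /= sub0r normrN. Qed.

Lemma ball_fibered j (r : R) : fibered j (ball (0 : 'rV[R]_2) r).
Proof. by move=> q t /ball0E qr t01; apply/ball0E; apply: le_lt_trans (segment_le _ _ t01) qr. Qed.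

Lemma hyp_proj_ball j (r : R) z : ball (0 : 'rV[R]_2) r z -> ball (0 : 'rV[R]_2) r (hyp_proj j z).
Proof. by move=> /ball0E zr; apply/ball0E; apply: le_lt_trans (hyp_proj_le _ _) zr. Qed.

Lemma derive_hyp_proj j A (g : 'rV[R]_2 -> R) z v : smooth_on A g -> A (hyp_proj j z) ->
  'D_v (fun q => g (hyp_proj j q)) z = 'D_(hyp_proj j v) g (hyp_proj j z).
Proof.
move=> sg Az; pose P : 'M[R]_2 := 1%:M - delta_mx j j.
have PE q : hyp_proj j q = q *m P.
  rewrite /hyp_proj /P mulmxBr mulmx1; congr (_ - _).
  by apply/rowP => i; rewrite !mxE (bigD1 j) //= !mxE eqxx big1 ?addr0 // => l lj;
    rewrite !mxE (negbTE lj) mulr0.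
have -> : (fun q => g (hyp_proj j q)) = g \o (fun q => q *m P).
  by apply/funext => q /=; rewrite PE.
have [d1 E1] := is_diff_mulmx P z.
have dg : differentiable g (z *m P) by rewrite -PE; exact: (smooth_diff sg).
have E2 : 'D_v (fun q => q *m P) z = hyp_proj j v by rewrite deriveE // E1 PE.
by rewrite [LHS]derive_comp //= E2 -PE.
Qed.

Lemma Cn_hyp_proj m j A : open A -> Cn m A (@hyp_proj R 2 j).
Proof.
move=> oA; apply: CnB => //; first exact: Cn_id.
by apply: Cn_scale_cst => //; exact: Cn_proj.
Qed.

Lemma powR_root (x : R) k : 0 <= x -> (x `^ k.+1%:R^-1) ^+ k.+1 = x.
Proof.
move=> x0; by rewrite -powR_mulrn ?powR_ge0 // -powRrM mulVf ?powRr1.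
Qed.

Lemma sign_gt0 (x : R) : x != 0 -> 0 < (-1) ^+ (x < 0)%R * x.
Proof.
move=> x0; have [xn|xp] := ltrP x 0; first by rewrite expr1 mulN1r oppr_gt0.
by rewrite expr0 mul1r lt_neqAle eq_sym x0.
Qed.

Lemma near_sign (a : 'rV[R]_2 -> R) A : open A -> A 0 -> smooth_on A a -> a 0 != 0 ->
  nbhs (0 : 'rV[R]_2) (fun z => 0 < (-1) ^+ (a 0 < 0)%R * a z).
Proof.
move=> oA A0 sa a0.
have C1 : {for (0 : 'rV[R]_2), continuous (fun z => (-1) ^+ (a 0 < 0)%R * a z)}.
  by apply: (@Cn_cont _ 0 _ _ A) => //; apply: CnM => //; exact: Cn_cst.
exact: (C1 _ (open_nbhs_nbhs (conj (@open_gt _ 0) (sign_gt0 a0)))).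
Qed.

(* [K = K 0 + x^3 a + y^2 b] with nonvanishing [a], [b]: absorb [a] and [b] into
   the coordinates. *)
Lemma split_normal_form A (K a b : 'rV[R]_2 -> R) : open A -> A 0 ->
  smooth_on A a -> smooth_on A b -> a 0 != 0 -> b 0 != 0 ->
  (forall z, A z -> K z = K 0 + z 0 0 ^+ 3 * a z + z 0 1 ^+ 2 * b z) ->
  exists A' C' phi psi (s t : bool),
    [/\ diffeomorphism A' C' phi psi, A' `<=` A, C' 0, psi 0 = 0 &
      forall y, C' y ->
        K (psi y) = K 0 + (-1) ^+ s * y 0 0 ^+ 3 + (-1) ^+ t * y 0 1 ^+ 2].
Proof.
move=> oA A0 sa sb a0 b0 KE.
pose s := (a 0 < 0)%R; pose t := (b 0 < 0)%R.
have nA : nbhs (0 : 'rV[R]_2) A by exact: open_nbhs_nbhs.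
have : nbhs (0 : 'rV[R]_2) (A `&` ((fun z => 0 < (-1) ^+ s * a z : Prop)
    `&` (fun z => 0 < (-1) ^+ t * b z : Prop))).
  by apply: filterI => //; apply: filterI; [exact: near_sign sa a0 | exact: near_sign sb b0].
move=> /nbhs_ballP[r /= r0 Hr]; pose D := ball (0 : 'rV[R]_2) r.
have oD : open D by exact: ball_open.
have D0 : D 0 by exact: ballxx.
have DA : D `<=` A by move=> z /Hr[].
have pa z : D z -> 0 < (-1) ^+ s * a z by move=> /Hr[_ []].
have pb z : D z -> 0 < (-1) ^+ t * b z by move=> /Hr[_ []].
(* On [D] the signs of a and b are constant, so these are the cube root of |a| and the square root
   of |b|. The sign is removed before the cube root too, since real powers are smooth for positive
   bases. *)
pose al z := ((-1) ^+ s * a z) `^ 3%:R^-1.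
pose be z := ((-1) ^+ t * b z) `^ 2%:R^-1.
have sal : smooth_on D al.
  move=> k; apply: Cn_powR => //; apply: CnM => //; first exact: Cn_cst.
  exact: Cn_sub (sa k).
have sbe : smooth_on D be.
  move=> k; apply: Cn_powR => //; apply: CnM => //; first exact: Cn_cst.
  exact: Cn_sub (sb k).
pose phi z : 'rV[R]_2 := \row_j (z 0 j * (if j == 0 then al z else be z)).
have sphi : smooth_on D phi.
  move=> k; apply: Cn_rV => //; apply: ord2P.
    apply: Cn_ext (CnM oD (Cn_proj 0 k oD) (sal k)) => // z _; by rewrite mxE.
  by apply: Cn_ext (CnM oD (Cn_proj 1 k oD) (sbe k)) => // z _; rewrite mxE.
have phi0 : phi 0 = 0 by apply/rowP => j; rewrite !mxE mul0r.
have Dphi v j : 'D_v phi 0 0 j = v 0 j * (if j == 0 then al 0 else be 0).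
  rewrite -derive_coord; last exact: (smooth_diff sphi).
  have -> : (fun z => phi z 0 j) = (fun z => z 0 j * (if j == 0 then al z else be z)).
    by apply/funext => z; rewrite mxE.
  pose ga z := if j == 0 then al z else be z.
  have dga : differentiable ga 0.
    by rewrite /ga; case: (j == 0); [exact: (smooth_diff sal) | exact: (smooth_diff sbe)].
  rewrite -[LHS]/('D_v ((fun z : 'rV[R]_2 => z 0 j) * ga) 0) deriveM; last 2 first.
  - by apply: diff_derivable; apply: (@diff_coord _ _ _ id).
  - exact: diff_derivable.
  by rewrite derive_proj mxE scale0r add0r mulrC.
have Ju : 'J phi 0 \in unitmx.
  apply: unitmx_inj => v; rewrite -deriveEjacobian; last exact: (smooth_diff sphi).
  move=> Dv; apply/rowP => j; have := Dphi v j; rewrite Dv mxE => /esym/eqP.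
  have c0 : (if j == 0 then al 0 else be 0) != 0.
    by case: (j == 0); rewrite gt_eqF // powR_gt0 // ?pa ?pb.
  by rewrite mulf_eq0 (negbTE c0) orbF => /eqP ->; rewrite ?mxE.
have [A' [C' [psi [[oA' oC' sA' sC'] [[AC CA psiK phiK] [A'0 A'D]]]]]] :=
  inverse_function oD sphi D0 Ju.
exists A', C', phi, psi, s, t; split.
- by split; split.
- by move=> z /A'D /DA.
- by rewrite -phi0; exact: AC.
- by rewrite -[in LHS]phi0 psiK.
move=> y Cy; have Az := CA y Cy; have Dz := A'D _ Az.
rewrite -[in RHS](phiK y Cy) KE; last exact: DA.
rewrite !mxE /= !exprMn (powR_root 2 (ltW (pa _ Dz))) (powR_root 1 (ltW (pb _ Dz))).
have sgn (i : bool) (x c : R) : x * c = (-1) ^+ i * (x * ((-1) ^+ i * c)).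
  by case: i; rewrite ?expr1 ?expr0; ring.
by rewrite -!sgn.
Qed.

Theorem A2_normal_form U g p B : open U -> U p -> smooth_on U g -> B \in unitmx ->
  (forall v, 'D_v g p = 0) -> (forall v, 'D_v ('D_(row 0 B) g) p = 0) ->
  'D_(row 1 B) ('D_(row 1 B) g) p != 0 ->
  'D_(row 0 B) ('D_(row 0 B) ('D_(row 0 B) g)) p != 0 ->
  Ak_point 2 g p.
Proof.
move=> oU Up sg Bu crit ker gYY gXXX; set X := row 0 B in ker gXXX; set Y := row 1 B in gYY.
split; first by apply: is_diff0 => //; exact: (smooth_diff sg).
have wX : 'D_X ('D_Y g) p = 0 by rewrite (Clairaut _ _ oU Up (sg 2%N)) ker.
have [A [C [psi [dif [[Ap AU C0 psi0] [wpsi psiX psiY psiY1]]]]]] :=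
  straightening oU Up (smooth_derive Y sg) Bu (crit Y) wX gYY.
have [[oA oC sA sC] [AC CA phiK psiK]] := dif.
have CU y : C y -> U (psi y) by move=> Cy; apply: AU; exact: CA.
pose K y := g (psi y).
have sK : smooth_on C K by exact: smooth_comp CU _ sg.
have crit' v : 'D_v g (psi 0) = 0 by rewrite psi0.
have K0 : K 0 = g p by rewrite /K psi0.
have Kcrit v : 'D_v K 0 = 0 by rewrite (derive_comp_at sC CU _ sg C0).
have K00 : 'D_(e_ 0) ('D_(e_ 0) K) 0 = 0.
  by rewrite (hessian_comp oC sC CU _ _ sg C0 crit') psiX psi0 ker.
have K000 : 'D_(e_ 0) ('D_(e_ 0) ('D_(e_ 0) K)) 0 != 0.
  have ker' v : 'D_v ('D_('D_(e_ 0) psi 0) g) (psi 0) = 0.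
    by rewrite psiX psi0; exact: ker.
  have := third_derivative_comp oC oU sC CU sg C0 crit' ker'.
  by rewrite psiX psi0 => H3; rewrite /K H3; exact: gXXX.
pose u := 'D_(e_ 1) psi 0; pose m := (u *m invmx B) 0 1.
have uE : u = 0 *: X + m *: Y by rewrite scale0r add0r; exact: psiY.
(* As D_u D_Y g = 1 at p, symmetry gives D_u D_u g = m D_u D_Y g = m; and m = 0 would make u zero,
   against that value 1. *)
have K11 : 'D_(e_ 1) ('D_(e_ 1) K) 0 != 0.
  rewrite (hessian_comp oC sC CU _ _ sg C0 crit') psi0 -/u.
  have -> : 'D_u ('D_u g) p = 'D_(0 *: X + m *: Y) ('D_u g) p by rewrite -uE.
  rewrite derive_lin2; last exact: (smooth_diff (smooth_derive u sg) Up).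
  rewrite mul0r add0r (Clairaut _ _ oU Up (sg 2%N)) psiY1 mulr1.
  apply/eqP => m0; move: psiY1; rewrite -/u uE m0 !scale0r addr0 derive0 => /esym/eqP.
  by rewrite oner_eq0.
(* The velocity of [psi] in the second coordinate is c Y, so the derivative of [K] is c times
   ['D_Y g] at [psi y], that is c times the second coordinate. *)
have KY y : C y -> y 0 1 = 0 -> 'D_(e_ 1) K y = 0.
  move=> Cy y1; have yE := psiY y Cy.
  set c := (_ *m invmx B) 0 1 in yE.
  have {}yE : 'D_(e_ 1) psi y = 0 *: X + c *: Y by rewrite scale0r add0r.
  rewrite (derive_comp_at sC CU _ sg Cy) yE.
  rewrite derive_lin2; last by apply: (smooth_diff sg); exact: CU.
  by rewrite wpsi // y1 mul0r mulr0 addr0.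
have : nbhs (0 : 'rV[R]_2) C by exact: open_nbhs_nbhs.
move=> /nbhs_ballP[r /= r0 rC].
pose D := ball (0 : 'rV[R]_2) r.
have oD : open D by exact: ball_open.
have D0 : D 0 by exact: ballxx.
have sKD : smooth_on D K by move=> k; exact: Cn_sub (sK k).
have projD j z : D z -> D (hyp_proj j z) by exact: hyp_proj_ball.
(* [L] is the restriction of [K] to the axis y = 0, extended constantly in y. The constant g p
   apart, [K] is the sum of [E], to be divided by x^3, and [F], to be divided by y^2. *)
pose L z := K (hyp_proj 1 z).
have sL : smooth_on D L.
  by move=> k; apply: (Cn_comp oD (projD 1)) (sKD k); exact: Cn_hyp_proj.
have DL z v : D z -> 'D_v L z = 'D_(hyp_proj 1 v) K (hyp_proj 1 z).
  by move=> Dz; apply: derive_hyp_proj sKD _; exact: projD.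
have proj_e0 : hyp_proj 1 (e_ 0) = e_ 0 by apply: hyp_proj_id; rewrite mxE.
have proj_e1 : hyp_proj 1 (e_ 1) = 0.
  by rewrite /hyp_proj mxE eqxx scale1r subrr.
have proj00 z : z 0 0 = 0 -> hyp_proj 1 z = 0.
  by move=> z0; apply: rV2P; rewrite ?hyp_proj_coord !mxE // z0 mulr0 subr0.
pose F z := K z - L z; pose E z := L z - g p.
have sF : smooth_on D F by move=> k; apply: CnB.
have sE : smooth_on D E by move=> k; apply: CnB => //; exact: Cn_cst.
have DF1 z : D z -> 'D_(e_ 1) F z = 'D_(e_ 1) K z.
  move=> Dz; rewrite -[LHS]/('D_(e_ 1) (K - L) z) deriveB; last 2 first.
  - by apply: diff_derivable; exact: (smooth_diff sKD).
  - by apply: diff_derivable; exact: (smooth_diff sL).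
  by rewrite DL // proj_e1 derive0 subr0.
have vF : vanishes 1 D 2 F.
  move=> z i Dz z1; case: i => [|[|i]] i2; last discriminate i2.
    have F0 : F z = 0 by rewrite /F /L (hyp_proj_id z1) subrr.
    exact: F0.
  have F1 : 'D_(e_ 1) F z = 0 by rewrite (DF1 z Dz); apply: KY => //; exact: rC.
  exact: F1.
have LE i z : D z -> nderive 0 i L z = nderive 0 i K (hyp_proj 1 z).
  elim: i z => //= i IH z Dz; rewrite (derive_ext _ oD IH Dz).
  rewrite (derive_hyp_proj _ (nderive_smooth 0 i sKD)) ?proj_e0 //; exact: projD.
have EL i z : nderive 0 i.+1 E z = nderive 0 i.+1 L z.
  by rewrite /nderive !iterSr derive_subcst.
have vE : vanishes 0 D 3 E.
  move=> z i Dz z0 i3; have pz := proj00 z z0.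
  case: i i3 => [|i] i3.
    have E0 : E z = 0 by rewrite /E /L pz K0 subrr.
    exact: E0.
  rewrite EL LE // pz; case: i i3 => [|[|i]] i3; last discriminate i3.
    exact: Kcrit.
  exact: K00.
have fD j : fibered j D by exact: ball_fibered.
have a0 : quotient 0 3 E 0 != 0.
  rewrite /quotient mxE eqxx; apply: mulf_neq0; last by rewrite invr_eq0 pnatr_eq0.
  have z0 : (0 : 'rV[R]_2) 0 0 = 0 by rewrite mxE.
  rewrite (EL 2%N 0) (LE _ _ D0) (proj00 _ z0); exact: K000.
have b0 : quotient 1 2 F 0 != 0.
  rewrite /quotient mxE eqxx; apply: mulf_neq0; last by rewrite invr_eq0 pnatr_eq0.
  have F2 : nderive 1 2 F 0 = 'D_(e_ 1) ('D_(e_ 1) K) 0 := derive_ext _ oD DF1 D0.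
  by rewrite F2; exact: K11.
have KE z : D z -> K z = K 0 + z 0 0 ^+ 3 * quotient 0 3 E z + z 0 1 ^+ 2 * quotient 1 2 F z.
  move=> Dz; rewrite -(quotientK vE Dz) -(quotientK vF Dz) K0 /E /F.
  by move: (K z) (L z) (g p) => *; ring.
have sa : smooth_on D (quotient 0 3 E) by move=> k; exact: quotient_Cn.
have sb : smooth_on D (quotient 1 2 F) by move=> k; exact: quotient_Cn.
have [A' [C' [phi' [psi' [s [t [dif' A'D C'0 psi'0 HK]]]]]]] :=
  split_normal_form oD D0 sa sb a0 b0 KE.
have A'C : A' `<=` C by move=> z /A'D /rC.
exists (A `&` straight B p ('D_Y g) @^-1` A'), C',
  (phi' \o straight B p ('D_Y g)), (psi \o psi'), (g p), s, t.
split=> //; first exact: diffeomorphism_comp dif dif' A'C.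
  by rewrite /= psi'0.
by move=> y Cy; rewrite -K0; exact: HK.
Qed.

End NormalForm.

(** * A_2 points through the third derivative along the kernel; tangents of level curves *)

Section A2Points.
Variable R : realType.
Implicit Types (p q v z : 'rV[R]_2) (B : 'M[R]_2) (U : set 'rV[R]_2).
Implicit Types (g : 'rV[R]_2 -> R) (j : 'I_2).

Local Notation e_ j := (delta_mx 0 j : 'rV[R]_2).

Lemma deriveZE (V : normedModType R) (f : V -> R) (a : R) (z v : V) : differentiable f z ->
  'D_v (fun y => a * f y) z = a * 'D_v f z.
Proof. by move=> df; exact: (deriveZ a (diff_derivable df)). Qed.

Lemma derive_dirZ (V : normedModType R) (f : V -> R) (a : R) (z v : V) : differentiable f z ->
  'D_(a *: v) f z = a * 'D_v f z.
Proof. by move=> df; rewrite !deriveE //; exact: linearZ. Qed.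

Lemma differentiable_coordX j k z : differentiable (fun z : 'rV[R]_2 => z 0 j ^+ k) z.
Proof. exact: (Cn_diff (CnX k openT (Cn_proj j 1 openT)) I). Qed.

Lemma derive_coordX j k z v :
  'D_v (fun z : 'rV[R]_2 => z 0 j ^+ k.+1) z = k.+1%:R * z 0 j ^+ k * v 0 j.
Proof.
have dj := differentiable_coordX j.
have d1 : differentiable (fun z : 'rV[R]_2 => z 0 j) z by apply: (@diff_coord _ _ _ id).
elim: k => [|k IH]; first by rewrite expr0 !mul1r derive_proj.
have E := @deriveM _ _ (fun z : 'rV[R]_2 => z 0 j) (fun z => z 0 j ^+ k.+1) z v
  (diff_derivable d1) (diff_derivable (dj k.+1 z)).
have -> : (fun z : 'rV[R]_2 => z 0 j ^+ k.+2) =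
    (fun z : 'rV[R]_2 => z 0 j) * (fun z => z 0 j ^+ k.+1).
  by apply/funext => y; rewrite exprS.
rewrite E IH derive_proj.
have sE (x y : R) : x *: y = x * y by [].
by rewrite !sE exprS -[k.+2%:R]natr1; ring.
Qed.

Lemma third_derivative_dirZ U g p v (a : R) : open U -> U p -> smooth_on U g ->
  'D_(a *: v) ('D_(a *: v) ('D_(a *: v) g)) p = a ^+ 3 * 'D_v ('D_v ('D_v g)) p.
Proof.
move=> oU Up sg; set u := a *: v.
have D1 z : U z -> 'D_u g z = a * 'D_v g z.
  by move=> Uz; apply: derive_dirZ; exact: (smooth_diff sg).
have D2 z : U z -> 'D_u ('D_u g) z = a * (a * 'D_v ('D_v g) z).
  move=> Uz; rewrite (derive_ext _ oU D1 Uz).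
  have d := smooth_diff (smooth_derive v sg) Uz.
  by rewrite deriveZE // derive_dirZ.
apply: (etrans (derive_ext u oU D2 Up)).
have d := smooth_diff (smooth_derive v (smooth_derive v sg)) Up.
have d' : differentiable (fun y => a * 'D_v ('D_v g) y) p by exact: (differentiableZ a d).
by rewrite deriveZE // deriveZE // derive_dirZ // exprS expr2 !mulrA.
Qed.

(** In the normal form the first coordinate vector spans the kernel of the Hessian and has third
    derivative 6 or -6. Its image by the differential of [psi] lies in the kernel of the Hessian of
    g, hence is x X for some x, and invariance equates that number with x^3 D_X^3 g. *)
Theorem A2_point_third_derivative U g p B : open U -> U p -> smooth_on U g -> B \in unitmx ->
  (forall v, 'D_v ('D_(row 0 B) g) p = 0) -> 'D_(row 1 B) ('D_(row 1 B) g) p != 0 ->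
  Ak_point 2 g p -> 'D_(row 0 B) ('D_(row 0 B) ('D_(row 0 B) g)) p != 0.
Proof.
move=> oU Up sg Bu; set X := row 0 B; set Y := row 1 B => ker gYY.
move=> [[dgp dg0] [A [C [phi [psi [c [s [t [dif C0 psi0 Hg]]]]]]]]].
have crit v : 'D_v g p = 0 by rewrite deriveE // dg0.
have [[oA oC sA sC] [AC CA phiK psiK]] := dif.
(* The chart of [Ak_point] is not tied to [U]; it is cut down so that [psi] stays where g is
   smooth. *)
pose C' := C `&` psi @^-1` U.
have oC' : open C'.
  rewrite openE => y [Cy Uy]; apply: filterI; first exact: open_nbhs_nbhs.
  exact: (Cn_cont (sC 0%N) Cy (open_nbhs_nbhs (conj oU Uy))).
have C'0 : C' 0 by split=> //; rewrite /preimage /= psi0.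
have sC' : smooth_on C' psi by move=> k; apply: Cn_sub (sC k) => y [].
have C'U y : C' y -> U (psi y) by case.
have crit' v : 'D_v g (psi 0) = 0 by rewrite psi0.
pose K y := g (psi y); pose a : R := (-1) ^+ s; pose b : R := (-1) ^+ t.
have KE y : C' y -> K y = c + (a * y 0 0 ^+ 3 + b * y 0 1 ^+ 2).
  by move=> [Cy _]; rewrite /K Hg // addrA.
have dX j k (x : R) z : differentiable (fun z : 'rV[R]_2 => x * z 0 j ^+ k) z.
  exact: (differentiableZ x (differentiable_coordX j k z)).
have K1 z : C' z -> 'D_(e_ 0) K z = a * 3 * z 0 0 ^+ 2.
  move=> Cz; rewrite (derive_ext _ oC' KE Cz).
  have E1 := @deriveD _ _ _ (fun z : 'rV[R]_2 => a * z 0 0 ^+ 3) (fun z => b * z 0 1 ^+ 2) z (e_ 0)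
    (diff_derivable (dX _ _ _ _)) (diff_derivable (dX _ _ _ _)).
  have E2 := @deriveD _ _ _ (cst c) (fun z : 'rV[R]_2 => a * z 0 0 ^+ 3 + b * z 0 1 ^+ 2) z (e_ 0)
    (derivable_cst _ _ _) (diff_derivable (differentiableD (dX _ _ _ _) (dX _ _ _ _))).
  rewrite [LHS]E2 derive_cst add0r [LHS]E1 !deriveZE; try exact: differentiable_coordX.
  by rewrite !derive_coordX !mxE /= !mulr0 addr0 mulr1 mulrA.
have K2 v z : C' z -> 'D_v ('D_(e_ 0) K) z = a * 3 * (2 * z 0 0 * v 0 0).
  move=> Cz; rewrite (derive_ext _ oC' K1 Cz) deriveZE; last exact: differentiable_coordX.
  by rewrite derive_coordX expr1.
have K3 : 'D_(e_ 0) ('D_(e_ 0) ('D_(e_ 0) K)) 0 = a * 6.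
  have K2' z : C' z -> 'D_(e_ 0) ('D_(e_ 0) K) z = a * 6 * z 0 0 ^+ 1.
    by move=> Cz; rewrite K2 // !mxE /= expr1; ring.
  rewrite (derive_ext _ oC' K2' C'0) deriveZE; last exact: differentiable_coordX.
  by rewrite derive_coordX expr0 !mxE /= !mulr1.
set e := 'D_(e_ 0) psi 0.
have phip : phi p = 0 by rewrite -psi0 psiK.
have Ap : A p by rewrite -psi0; exact: CA.
have surj u : exists w, 'D_w psi 0 = u.
  exists ('D_u phi p); rewrite -phip -derive_comp.
  - by rewrite (@derive_ext _ _ _ A (psi \o phi) id p u oA) // derive_id.
  - exact: (smooth_diff sA).
  - by rewrite phip; exact: (smooth_diff sC).
(* Every u is a velocity of [psi] at 0, and the derivative of [K] along the first coordinate, a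
   multiple of x^2, has zero differential there. *)
have ker_e u : 'D_u ('D_e g) p = 0.
  have [w <-] := surj u.
  have := hessian_comp oC' sC' C'U (e_ 0) w sg C'0 crit'; rewrite psi0 -/e => <-.
  by rewrite (K2 w 0 C'0) !mxE mulr0 mul0r mulr0.
have ker_e' u : 'D_u ('D_('D_(e_ 0) psi 0) g) (psi 0) = 0 by rewrite psi0; exact: ker_e.
have := third_derivative_comp oC' oU sC' C'U sg C'0 crit' ker_e'.
rewrite psi0 -/e => H3.
have eE := basis2 e Bu; rewrite -/X -/Y in eE.
set x := (_ *m invmx B) 0 0 in eE; set y := (_ *m invmx B) 0 1 in eE.
clearbody e x y.
(* Pair e = x X + y Y with Y in the Hessian: the X term vanishes, and D_Y D_Y g is nonzero. *)
have y0 : y = 0.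
  have : 'D_e ('D_Y g) p = 0 by rewrite (Clairaut _ _ oU Up (sg 2%N)); exact: ker_e.
  rewrite eE derive_lin2; last exact: (smooth_diff (smooth_derive Y sg) Up).
  rewrite (Clairaut _ _ oU Up (sg 2%N)) ker mulr0 add0r => /eqP.
  by rewrite mulf_eq0 (negbTE gYY) orbF => /eqP.
have {}eE : e = x *: X by rewrite eE y0 scale0r addr0.
have H4 := third_derivative_dirZ X x oU Up sg; rewrite -eE in H4.
rewrite /K in K3.
have H5 := etrans (esym K3) (etrans H3 H4).
apply/eqP => gXXX; have : a * 6 != 0 by rewrite mulf_neq0 ?signr_eq0 ?pnatr_eq0.
by rewrite H5 gXXX mulr0 eqxx.
Qed.

Lemma exists_basis (g : 'rV[R]_2 -> R) p (X Y : 'rV[R]_2) : X != 0 -> differentiable g p ->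
  'D_X g p = 0 -> 'D_Y g p != 0 ->
  exists B, [/\ row 0 B = X, row 1 B = Y & B \in unitmx].
Proof.
move=> X0 dg gX gY; exists (\matrix_(i, j) (if i == 0 then X 0 j else Y 0 j)).
set B := \matrix_(_, _) _.
have B0 : row 0 B = X by apply/rowP => j; rewrite !mxE.
have B1 : row 1 B = Y by apply/rowP => j; rewrite !mxE.
split=> //; apply: unitmx_inj => u; rewrite mulmx_sum_row sum_ord2 B0 B1 => Hu.
have u1 : u 0 1 = 0.
  have : 'D_(u 0 0 *: X + u 0 1 *: Y) g p = 0 by rewrite Hu derive0.
  rewrite derive_lin2 // gX mulr0 add0r => /eqP.
  by rewrite mulf_eq0 (negbTE gY) orbF => /eqP.
move: Hu; rewrite u1 scale0r addr0 => /eqP; rewrite scaler_eq0 (negbTE X0) orbF => /eqP u0.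
by apply: rV2P; rewrite ?u0 ?u1 !mxE.
Qed.

Theorem A2_pointP U g p (X Y : 'rV[R]_2) : open U -> U p -> smooth_on U g -> X != 0 ->
  (forall v, 'D_v g p = 0) -> (forall v, 'D_v ('D_X g) p = 0) -> 'D_Y ('D_Y g) p != 0 ->
  Ak_point 2 g p <-> 'D_X ('D_X ('D_X g)) p != 0.
Proof.
move=> oU Up sg X0 crit ker YY.
have XY : 'D_X ('D_Y g) p = 0 by rewrite (Clairaut _ _ oU Up (sg 2%N)).
(* The differential of ['D_Y g] at p vanishes on X and not on Y, which makes X and Y independent. *)
have [B [EX EY Bu]] := exists_basis X0 (smooth_diff (smooth_derive Y sg) Up) XY YY.
subst X Y; split=> H; first exact: A2_point_third_derivative oU Up sg Bu ker YY H.
exact: A2_normal_form oU Up sg Bu crit ker YY H.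
Qed.

(** A curve in the level set satisfies w (gamma t) = 0, whose derivative is D_X w. Conversely, in
    coordinates with w as second coordinate and X as image of the first coordinate vector, the first
    axis is a curve in the level set with velocity X. *)
Theorem tangent_to_level_set U (w : 'rV[R]_2 -> R) p X : open U -> U p -> smooth_on U w ->
  w p = 0 -> (exists v, 'd w p v != 0) -> X != 0 ->
  tangent_to [set q | U q /\ w q = 0] p X <-> 'D_X w p = 0.
Proof.
move=> oU Up sw w0 [v dv] X0; have dwp := smooth_diff sw Up; split.
  move=> [I [gamma [[oI I0 sI Iw] [g0 gX]]]].
  have dg : differentiable gamma 0 by exact: (smooth_diff sI).
  rewrite -gX derive1E -g0 -derive_comp //; last by rewrite g0.
  rewrite (@derive_ext _ _ _ I (w \o gamma) (cst 0) 0 1 oI) ?derive_cst //.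
  by move=> t /Iw[].
move=> wX; have wv : 'D_v w p != 0 by rewrite deriveE.
have [B [B0 B1 Bu]] := exists_basis X0 dwp wX wv.
have wB0 : 'D_(row 0 B) w p = 0 by rewrite B0.
have wB1 : 'D_(row 1 B) w p != 0 by rewrite B1.
have [A [C [psi [[[oA oC sA sC] [AC CA _ _]] [[Ap AU C0 psi0] [wpsi psiX _ _]]]]]] :=
  straightening oU Up sw Bu w0 wB0 wB1.
pose ell (t : R) : 'rV[R]_2 := t *: e_ 0.
have sell A' : open A' -> smooth_on A' ell.
  by move=> oA' k; apply: Cn_scale_cst => //; exact: Cn_id.
have oI : open [set t | C (ell t)].
  rewrite openE => t Ct.
  exact: (Cn_cont (sell setT openT 0%N) (I : setT t) (open_nbhs_nbhs (conj oC Ct))).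
have ell0 : ell 0 = 0 by exact: scale0r.
exists [set t | C (ell t)], (fun t => psi (ell t)); split.
  split=> //; first by rewrite /= ell0.
    move=> k; apply: (@Cn_comp_rV _ _ _ _ _ _ C) (sC k) => //; exact: sell.
  by move=> t Ct; split; [apply: AU; exact: CA | rewrite wpsi // !mxE mulr0].
split; first by rewrite ell0.
have dell : is_diff (0 : R) ell ell by exact: is_diff_scalel.
have [d1 E1] := dell.
have dpsi : differentiable psi (ell 0) by rewrite ell0; exact: (smooth_diff sC).
rewrite derive1E -[LHS]/('D_1 (psi \o ell) 0) derive_comp //.
by rewrite (deriveE _ d1) E1 ell0 /ell scale1r psiX B0.
Qed.

End A2Points.
(** * Line congruences *)

(* With [N = S - l] and [k = h(X, .)], both [N] and [X (x) k] have kernel and image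
   spanned by [X], hence they are proportional. *)
Lemma nilpotent_pairing (R : realType) (a b c d l x0 x1 h00 h01 h10 h11 : R) :
  a + d = 2 * l -> a * d - b * c = l ^+ 2 ->
  [|| a - l != 0, b != 0 | c != 0] ->
  (x0 != 0) || (x1 != 0) ->
  (a - l) * x0 + b * x1 = 0 -> c * x0 + (d - l) * x1 = 0 ->
  h00 * h11 - h01 * h10 != 0 ->
  h00 * b + h01 * (d - l) = h10 * (a - l) + h11 * c ->
  exists2 mu : R, mu != 0 & forall a' b' c' d' : R,
    (x0 * h00 + x1 * h10) * (a' * x0 + b' * x1) +
    (x0 * h01 + x1 * h11) * (c' * x0 + d' * x1) =
    mu * (2 * (a - d) * (a' - d') + 4 * (b' * c + b * c')).
Proof.
move=> tr det Nne xne e1 e2 hne sym.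
pose m := a - l; have dl : d - l = - m by rewrite /m; lra.
rewrite dl in e2 sym; rewrite -/m in e1 sym Nne.
have ad : a - d = 2 * m by rewrite /m; lra.
have mbc : m ^+ 2 + b * c = 0.
  have dE : d = 2 * l - a by lra.
  by move: det; rewrite dE /m => H; nra.
pose k0 := x0 * h00 + x1 * h10; pose k1 := x0 * h01 + x1 * h11.
(* This and [k_b] say that k N = 0: by symmetry h(X, N e_j) = h(e_j, N X), and N X = 0. *)
have k_m : k0 * m + k1 * c = 0.
  have -> : k0 * m + k1 * c = h00 * (m * x0 + b * x1) + h01 * (c * x0 + - m * x1)
     - x1 * (h00 * b + h01 * - m - (h10 * m + h11 * c)) by rewrite /k0 /k1; ring.
  by rewrite e1 e2 sym subrr !mulr0 addr0 subr0.
have k_b : k0 * b - k1 * m = 0.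
  have -> : k0 * b - k1 * m = h10 * (m * x0 + b * x1) + h11 * (c * x0 + - m * x1)
     + x0 * (h00 * b + h01 * - m - (h10 * m + h11 * c)) by rewrite /k0 /k1; ring.
  by rewrite e1 e2 sym subrr !mulr0 !addr0.
have kne : ~ (k0 = 0 /\ k1 = 0).
  move=> [z0 z1]; move/negP: hne; apply.
  have E0 : x0 * (h00 * h11 - h01 * h10) = k0 * h11 - k1 * h10 by rewrite /k0 /k1; ring.
  have E1 : x1 * (h00 * h11 - h01 * h10) = k1 * h00 - k0 * h01 by rewrite /k0 /k1; ring.
  rewrite z0 z1 !mul0r subrr in E0 E1.
  case/orP: xne => xn; [move/eqP: E0 | move/eqP: E1]; by rewrite mulf_eq0 (negbTE xn).
(* It is enough that X (x) k = mu N entry by entry: the left side is then mu tr (N S') and the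
   bracket on the right is 4 tr (N S'), with S' the matrix of primed entries. *)
have fin mu : x0 * k0 = mu * m -> x0 * k1 = mu * b -> x1 * k0 = mu * c ->
    x1 * k1 = - (mu * m) -> forall a' b' c' d' : R,
    k0 * (a' * x0 + b' * x1) + k1 * (c' * x0 + d' * x1) =
    mu / 4 * (2 * (a - d) * (a' - d') + 4 * (b' * c + b * c')).
  move=> E0 E1 E2 E3 a' b' c' d'; rewrite ad.
  have -> : k0 * (a' * x0 + b' * x1) + k1 * (c' * x0 + d' * x1) =
    a' * (x0 * k0) + b' * (x1 * k0) + c' * (x0 * k1) + d' * (x1 * k1) by ring.
  by rewrite E0 E1 E2 E3; field.
(* The factor is read off from a nonzero entry of N: for b = 0 the relation m^2 + b c = 0 leaves
   only c, otherwise b itself serves. *)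
have [b0|b0] := eqVneq b 0.
  have m0 : m = 0 by apply/eqP; rewrite -sqrf_eq0; apply/eqP; move: mbc; rewrite b0 mul0r addr0.
  have c0 : c != 0 by move: Nne; rewrite b0 m0 !eqxx.
  have x00 : x0 = 0.
    move: e2; rewrite m0 oppr0 mul0r addr0 => /eqP; rewrite mulf_eq0 (negbTE c0) /=.
    by move/eqP.
  have k10 : k1 = 0.
    move: k_m; rewrite m0 mulr0 add0r => /eqP; rewrite mulf_eq0 (negbTE c0) orbF.
    by move/eqP.
  exists (x1 * k0 / c / 4).
    rewrite !mulf_neq0 ?invr_eq0 ?pnatr_eq0 //; first by move: xne; rewrite x00 eqxx.
    by apply/eqP => z0; apply: kne.
  apply: fin; rewrite ?x00 ?k10 ?m0 ?b0 ?mulr0 ?mul0r ?oppr0 //.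
  by rewrite divfK.
have x00 : x0 != 0.
  apply/eqP => z0; move: e1 xne; rewrite z0 mulr0 add0r eqxx /= => /eqP.
  by rewrite mulf_eq0 (negbTE b0) /= => /eqP ->; rewrite eqxx.
have k10 : k1 != 0.
  apply/eqP => z0; apply: kne; split=> //; apply/eqP; move/eqP: k_b.
  by rewrite z0 mul0r subr0 mulf_eq0 (negbTE b0) orbF.
exists (x0 * k1 / b / 4); first by rewrite !mulf_neq0 ?invr_eq0 ?pnatr_eq0.
have bx : b * x1 = - (m * x0) by lra.
have bk : b * k0 = k1 * m by lra.
apply: fin; apply: (mulfI b0).
- by rewrite mulrCA bk; field.
- by field.
- have -> : b * (x1 * k0) = b * x1 * k0 by ring.
  have -> : b * (x0 * k1 / b * c) = x0 * (k1 * c) by field.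
  have -> : k1 * c = - (k0 * m) by lra.
  by rewrite bx; ring.
- rewrite mulrA bx; by field.
Qed.

(** * Moving frame of an equiaffine pair and derivatives of the support function *)

Section CongruenceGeometry.
Variables (R : realType) (U : set 'rV[R]_2) (f xi : 'rV[R]_2 -> 'rV[R]_3) (Z : 'rV[R]_3).
Hypotheses (hcong : line_congruence f xi U) (hequi : equiaffine f xi U).
Implicit Types (q v w : 'rV[R]_2) (i j k : 'I_2).

Local Notation e_ j := (delta_mx 0 j : 'rV[R]_2).

Let oU : open U. Proof. by case: hcong. Qed.
Let sf : smooth_on U f. Proof. by case: hcong. Qed.
Let sxi : smooth_on U xi. Proof. by case: hcong. Qed.

Lemma congruence_frame_unit q : U q -> frame f xi q \in unitmx.
Proof. by move=> Uq; case: hcong => _ _ _ Hi Ht; apply: frame_unit; [exact: Hi | exact: Ht]. Qed.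

Lemma frame_lshift q i l : U q -> frame f xi q (lshift 1 i) l = 'D_(e_ i) f q 0 l.
Proof.
move=> Uq; rewrite /frame (@col_mxEu _ 2 1 3) jacobianE //; exact: (smooth_diff sf Uq).
Qed.

Lemma frame_rshift q l : frame f xi q (rshift 2 0) l = xi q 0 l.
Proof. by rewrite /frame (@col_mxEd _ 2 1 3). Qed.

Lemma frame_smooth a l : smooth_on U (fun q => frame f xi q a l).
Proof.
move=> n; rewrite -[a](@fintype.splitK 2 1 a).
case: (@fintype.split 2 1 a) => i /=.
  apply: Cn_ext (Cn_coord l oU (Cn_derive (e_ i) (sf n.+1))) => // q Uq.
  by rewrite frame_lshift.
apply: Cn_ext (Cn_coord l oU (sxi n)) => // q Uq.
by rewrite (ord1 i) frame_rshift.
Qed.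

Lemma coords_smooth (w : 'rV[R]_2 -> 'rV[R]_3) a : smooth_on U w ->
  smooth_on U (fun q => coords f xi q (w q) 0 a).
Proof.
move=> sw n.
have H (k : 'I_3) : true -> Cn n U (fun q => w q 0 k * invmx (frame f xi q) k a).
  move=> _; apply: CnM => //; first exact: Cn_coord (sw n).
  by apply: Cn_invmx => // [q /congruence_frame_unit//|k' l]; exact: frame_smooth.
by apply: Cn_ext (Cn_sum (index_enum 'I_3) oU H) => // q _; rewrite mxE.
Qed.

Definition offset q : 'rV[R]_(2 + 1) := coords f xi q (Z - f q).
(* [offset] holds the coordinates of [Z - f] in the frame: the first two are [alpha], the
   last one is the support function. *)
Definition tangential i q : R := offset q 0 (lshift 1 i).

Lemma support_funE q : support_fun f xi Z q = offset q 0 (rshift 2 0).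
Proof.
rewrite /offset /coords mxE /support_fun; apply: eq_bigr => i _.
by rewrite /conormal !mxE mulrC.
Qed.

Lemma offset_smooth a : smooth_on U (fun q => offset q 0 a).
Proof.
apply: coords_smooth => n; apply: CnB; [exact: oU | exact: Cn_cst | exact: sf].
Qed.

Lemma tangential_smooth i : smooth_on U (tangential i).
Proof. exact: offset_smooth. Qed.

Lemma support_fun_smooth : smooth_on U (support_fun f xi Z).
Proof.
move=> n; apply: Cn_ext (offset_smooth (rshift 2 0) n); first exact: oU.
by move=> q _; rewrite support_funE.
Qed.

Lemma hess_coords_smooth k i a : smooth_on U (fun q => coords f xi q (hess f q k i) 0 a).
Proof. by apply: coords_smooth; apply: smooth_derive; exact: smooth_derive. Qed.

Lemma second_form_smooth k i : smooth_on U (fun q => second_form f xi q k i).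
Proof.
move=> n; apply: Cn_ext (hess_coords_smooth k i (rshift 2 0) n); first exact: oU.
by move=> q _; rewrite !mxE.
Qed.

Lemma connection_smooth k i j : smooth_on U (fun q => connection f xi q k i 0 j).
Proof.
move=> n; apply: Cn_ext (hess_coords_smooth k i (lshift 1 j) n); first exact: oU.
by move=> q _; rewrite !mxE.
Qed.

Lemma coords_row n q (M : 'M[R]_(n, 3)) (v : 'rV[R]_n) :
  coords f xi q (v *m M) = v *m coords f xi q M.
Proof. by rewrite /coords mulmxA. Qed.

Lemma shape_smooth i j : smooth_on U (fun q => shape f xi q i j).
Proof.
move=> n.
have H : smooth_on U (fun q => coords f xi q ('D_(e_ j) xi q) 0 (lshift 1 i)).
  by apply: coords_smooth; exact: smooth_derive.
apply: Cn_ext (CnN oU (H n)); first exact: oU.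
move=> q Uq; rewrite deriveEjacobian; last exact: (smooth_diff sxi Uq).
by rewrite coords_row -rowE !mxE.
Qed.

Lemma coords_xi q v : U q ->
  coords f xi q ('D_v xi q) = row_mx (- (v *m (shape f xi q)^T)) 0.
Proof.
move=> Uq; have [tau0 _] := hequi Uq.
rewrite deriveEjacobian; last exact: (smooth_diff sxi Uq).
rewrite coords_row -[coords f xi q _]hsubmxK mul_mx_row; congr row_mx.
  by rewrite /shape linearN /= trmxK mulmxN opprK.
by rewrite -/(tau f xi q) tau0 mulmx0.
Qed.

Lemma coords_f q v : U q -> coords f xi q ('D_v f q) = row_mx v 0.
Proof.
move=> Uq; rewrite deriveEjacobian; last exact: (smooth_diff sf Uq).
rewrite /coords.
have -> : v *m 'J f q = (row_mx v 0 : 'rV[R]_(2 + 1)) *m (frame f xi q : 'M[R]_(2 + 1, 3)).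
  by rewrite /frame mul_row_col mul0mx addr0.
by rewrite -mulmxA mulmxV ?mulmx1 // congruence_frame_unit.
Qed.

Lemma derive_sum_prod n (a b : 'I_n -> 'rV[R]_2 -> R) q v :
  (forall l, differentiable (a l) q) -> (forall l, differentiable (b l) q) ->
  'D_v (fun z => \sum_l a l z * b l z) q =
  \sum_l ('D_v (a l) q * b l q + a l q * 'D_v (b l) q).
Proof.
move=> da db.
have -> : (fun z => \sum_l a l z * b l z) = \sum_l (fun z => a l z * b l z).
  by apply/funext => z; rewrite fct_sumE.
have dab l : derivable (fun z => a l z * b l z) q v.
  by apply: diff_derivable; exact: differentiableM.
rewrite derive_sum //; apply: eq_bigr => l _.
rewrite (@deriveM _ _ (a l) (b l) q v (diff_derivable (da l)) (diff_derivable (db l))).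
by rewrite addrC [_ *: 'D_v (a l) q]mulrC.
Qed.

Lemma derive_frame_lshift q v i : U q ->
  'D_v ('D_(e_ i) f) q = \sum_k v 0 k *: hess f q k i.
Proof. by move=> Uq; apply: derive_rV_sum; exact: (smooth_diff (smooth_derive _ sf) Uq). Qed.

(* Differentiate [Z - f = offset *m frame]. *)
Lemma derive_offset q v : U q ->
  \row_a 'D_v (fun z => offset z 0 a) q =
  - row_mx v 0 - \sum_i tangential i q *: \sum_k v 0 k *: coords f xi q (hess f q k i)
  + support_fun f xi Z q *: row_mx (v *m (shape f xi q)^T) 0 :> 'rV[R]_(2 + 1).
Proof.
move=> Uq; have Fu := congruence_frame_unit Uq.
set D := \row_a _.
(* The product rule is applied to [offset] times the frame, and the frame is inverted afterwards;
   thus the inverse frame is never differentiated. *)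
have key : D *m (frame f xi q : 'M[R]_(2 + 1, 3)) =
    - 'D_v f q - \sum_i tangential i q *: 'D_v ('D_(e_ i) f) q
    - support_fun f xi Z q *: 'D_v xi q.
  apply/rowP => l.
  have E z : U z -> Z 0 l - f z 0 l =
      \sum_(a < 2 + 1) offset z 0 a * (frame f xi z : 'M[R]_(2 + 1, 3)) a l.
    move=> Uz; have H : offset z *m (frame f xi z : 'M[R]_(2 + 1, 3)) = Z - f z.
      by rewrite /offset /coords mulmxKV // congruence_frame_unit.
    by transitivity ((Z - f z) 0 l); [rewrite !mxE | rewrite -H mxE].
  have da b : differentiable (fun z => offset z 0 b) q by exact: (smooth_diff (offset_smooth b) Uq).
  have dF b : differentiable (fun z => frame f xi z b l) q by exact: (smooth_diff (frame_smooth b l) Uq).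
  have dfl : differentiable (fun z => f z 0 l) q by apply: diff_coord; exact: (smooth_diff sf Uq).
  have DE : - 'D_v f q 0 l = \sum_(b < 2 + 1) ('D_v (fun z => offset z 0 b) q * frame f xi q b l
      + offset q 0 b * 'D_v (fun z => frame f xi z b l) q).
    rewrite -(derive_sum_prod v da dF) -(derive_ext v oU E Uq).
    have := @deriveB _ _ _ (cst (Z 0 l)) (fun z => f z 0 l) q v (derivable_cst _ _ _) (diff_derivable dfl).
    rewrite derive_cst sub0r derive_coord; last exact: (smooth_diff sf Uq).
    by move=> ->.
  rewrite big_split /= in DE.
  have -> : (D *m (frame f xi q : 'M[R]_(2 + 1, 3))) 0 l =
      \sum_(b < 2 + 1) 'D_v (fun z => offset z 0 b) q * frame f xi q b l.
    by rewrite mxE; apply: eq_bigr => b _; rewrite mxE.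
  move/eqP: DE; rewrite -subr_eq => /eqP <-.
  rewrite big_split_ord /=.
  have F1 i : 'D_v (fun z => frame f xi z (lshift 1 i) l) q = 'D_v ('D_(e_ i) f) q 0 l.
    rewrite (derive_ext v oU (fun z => @frame_lshift z i l) Uq) derive_coord //.
    exact: (smooth_diff (smooth_derive (e_ i) sf) Uq).
  have F2 : 'D_v (fun z => frame f xi z (rshift 2 0) l) q = 'D_v xi q 0 l.
    have -> : (fun z => frame f xi z (rshift 2 0) l) = (fun z => xi z 0 l).
      by apply/funext => z; exact: frame_rshift.
    by rewrite derive_coord //; exact: (smooth_diff sxi Uq).
  have -> : \sum_(b < 1) offset q 0 (rshift 2 b) * 'D_v (fun z => frame f xi z (rshift 2 b) l) q
      = support_fun f xi Z q * 'D_v xi q 0 l.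
    by rewrite big_ord1 support_funE -F2.
  move: ('D_v f q) ('D_v xi q) => A1 A2; rewrite opprD addrA.
  have entry (M1 M2 M3 : 'rV[R]_3) : (- M1 - M2 - M3) 0 l = - M1 0 l - M2 0 l - M3 0 l.
    by rewrite !mxE.
  rewrite entry summxE [(_ *: A2) 0 l]mxE; congr (_ - _ - _).
  by apply: eq_bigr => i _; rewrite F1 [RHS]mxE.
have -> : D = (D *m (frame f xi q : 'M[R]_(2 + 1, 3))) *m invmx (frame f xi q).
  by rewrite -mulmxA mulmxV // mulmx1.
rewrite key !mulmxBl mulNmx mulmx_suml.
rewrite -/(coords f xi q ('D_v f q)) coords_f //.
rewrite -scalemxAl -/(coords f xi q ('D_v xi q)) coords_xi //.
have opp_row (w : 'rV[R]_2) : row_mx (- w) (0 : 'rV[R]_1) = - row_mx w 0.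
  by rewrite opp_row_mx oppr0.
rewrite opp_row scalerN opprK; congr (_ - _ + _).
apply: eq_bigr => i _; rewrite -scalemxAl derive_frame_lshift // mulmx_suml.
by congr (_ *: _); apply: eq_bigr => k _; rewrite -scalemxAl.
Qed.

(** The value h(v, e_i), as a function of the point. *)
Definition covector v i q : R := \sum_k v 0 k * second_form f xi q k i.

Lemma covector_smooth v i : smooth_on U (covector v i).
Proof.
move=> n; apply: Cn_sum => // k _; apply: CnM => //; first exact: Cn_cst.
exact: second_form_smooth.
Qed.

(** The xi-coordinate of [derive_offset]: v is tangential, and the vanishing of [tau] removes the
    contribution of D_v xi, so only the Gauss equation contributes. *)
Lemma derive_support q v : U q ->
  'D_v (support_fun f xi Z) q = - \sum_i tangential i q * covector v i q.
Proof.
move=> Uq; have -> : support_fun f xi Z = (fun z => offset z 0 (rshift 2 0)).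
  by apply/funext => z; exact: support_funE.
have := congr1 (fun w : 'rV[R]_(2 + 1) => rsubmx w 0 0) (derive_offset v Uq).
rewrite linearD linearB linearN linear_sum linearZ /= !row_mxKr oppr0 scaler0 sub0r addr0.
rewrite [LHS]mxE [LHS]mxE => ->.
rewrite mxE summxE; congr (- _); apply: eq_bigr => i _.
rewrite linearZ linear_sum mxE summxE; congr (_ * _); apply: eq_bigr => k _.
by rewrite linearZ /second_form !mxE.
Qed.

(** The j-th coordinate of Gamma(v, e_i), the covariant derivative along v of the i-th coordinate
    field. *)
Definition transport v i j q : R := \sum_k v 0 k * connection f xi q k i 0 j.

Lemma transport_smooth v i j : smooth_on U (transport v i j).
Proof.
move=> n; apply: Cn_sum => // k _; apply: CnM => //; first exact: Cn_cst.
exact: connection_smooth.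
Qed.

(** The j-th coordinate of S v. *)
Definition shape_row v j q : R := \sum_k v 0 k * shape f xi q j k.

Lemma shape_row_smooth v j : smooth_on U (shape_row v j).
Proof.
move=> n; apply: Cn_sum => // k _; apply: CnM => //; first exact: Cn_cst.
exact: shape_smooth.
Qed.

Lemma derive_tangential q v j : U q ->
  'D_v (tangential j) q = - v 0 j - \sum_i tangential i q * transport v i j q
                          + support_fun f xi Z q * shape_row v j q.
Proof.
move=> Uq; have := congr1 (fun w : 'rV[R]_(2 + 1) => lsubmx w 0 j) (derive_offset v Uq).
rewrite linearD linearB linearN linear_sum linearZ /= !row_mxKl.
rewrite [LHS]mxE [LHS]mxE => ->.
have entry (M1 M2 M3 : 'rV[R]_2) : (- M1 - M2 + M3) 0 j = - M1 0 j - M2 0 j + M3 0 j.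
  by rewrite !mxE.
rewrite entry summxE [(_ *: (v *m _)) 0 j]mxE; congr (_ - _ + _).
  apply: eq_bigr => i _; rewrite linearZ linear_sum mxE summxE; congr (_ * _).
  by apply: eq_bigr => k _; rewrite linearZ /connection !mxE.
by congr (_ * _); rewrite mxE; apply: eq_bigr => k _; rewrite mxE.
Qed.

(** * Derivatives at p when Z = f(p) + xi(p) / l *)

Variables (p : 'rV[R]_2) (l : R).
Hypotheses (hp : U p) (hZ : Z = f p + l^-1 *: xi p).

Lemma offset_focal : offset p = row_mx 0 (l^-1)%:M.
Proof.
have E : coords f xi p (xi p) = row_mx 0 1%:M.
  have {1}-> : xi p = (row_mx 0 1%:M : 'rV[R]_(2 + 1)) *m (frame f xi p : 'M[R]_(2 + 1, 3)).
    by rewrite /frame mul_row_col mul0mx add0r mul1mx.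
  by rewrite /coords -mulmxA mulmxV ?congruence_frame_unit // mulmx1.
have -> : offset p = l^-1 *: coords f xi p (xi p).
  by rewrite /offset hZ [f p + _]addrC addrK /coords -scalemxAl.
by rewrite E (@scale_row_mx R 1 2 1) scaler0 scale_scalar_mx mulr1.
Qed.

Lemma tangential_focal i : tangential i p = 0.
Proof. by rewrite /tangential offset_focal row_mxEl mxE. Qed.

Lemma support_fun_focal : support_fun f xi Z p = l^-1.
Proof. by rewrite support_funE offset_focal row_mxEr mxE eqxx. Qed.

Lemma support_critical v : 'D_v (support_fun f xi Z) p = 0.
Proof.
rewrite derive_support // big1 ?oppr0 // => i _.
by rewrite tangential_focal mul0r.
Qed.

Lemma derive_tangential_focal v j :
  'D_v (tangential j) p = l^-1 * shape_row v j p - v 0 j.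
Proof.
rewrite derive_tangential // big1 ?subr0 => [|i _]; last by rewrite tangential_focal mul0r.
by rewrite support_fun_focal addrC.
Qed.

Lemma derive_opp_sum_prod n (a b : 'I_n -> 'rV[R]_2 -> R) q v :
  (forall l, differentiable (a l) q) -> (forall l, differentiable (b l) q) ->
  'D_v (fun z => - \sum_l a l z * b l z) q =
  - \sum_l ('D_v (a l) q * b l q + a l q * 'D_v (b l) q).
Proof.
move=> da db; rewrite -derive_sum_prod //.
have dab m : derivable (fun z => a m z * b m z) q v.
  by apply: diff_derivable; exact: differentiableM.
have ds : derivable (fun z => \sum_l a l z * b l z) q v.
  have -> : (fun z => \sum_l a l z * b l z) = \sum_l (fun z => a l z * b l z).
    by apply/funext => z; rewrite fct_sumE.
  exact: derivable_sum.
exact: (deriveN ds).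
Qed.

Lemma support_hessian v w :
  'D_w ('D_v (support_fun f xi Z)) p = - \sum_i 'D_w (tangential i) p * covector v i p.
Proof.
rewrite (derive_ext w oU (fun z => @derive_support z v) hp).
rewrite derive_opp_sum_prod; last 2 first.
- by move=> i; exact: (smooth_diff (tangential_smooth i) hp).
- by move=> i; exact: (smooth_diff (covector_smooth v i) hp).
by congr (- _); apply: eq_bigr => i _; rewrite tangential_focal mul0r addr0.
Qed.

(** As alpha and D_v alpha vanish at p, only D_v D_v alpha paired with h(v, .) survives in the third
    derivative. For the same reason, and because D_v rho = 0, that second derivative reduces to rho
    D_v (S v). *)
Lemma support_third v : (forall i, 'D_v (tangential i) p = 0) ->
  'D_v ('D_v ('D_v (support_fun f xi Z))) p =
  - \sum_i l^-1 * 'D_v (shape_row v i) p * covector v i p.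
Proof.
move=> Dt0.
have dt i q : U q -> differentiable (tangential i) q by exact: (smooth_diff (tangential_smooth i)).
have dc i q : U q -> differentiable (covector v i) q by exact: (smooth_diff (covector_smooth v i)).
have dt' i q : U q -> differentiable ('D_v (tangential i)) q.
  exact: (smooth_diff (smooth_derive v (tangential_smooth i))).
have dc' i q : U q -> differentiable ('D_v (covector v i)) q.
  exact: (smooth_diff (smooth_derive v (covector_smooth v i))).
have D2 q : U q -> 'D_v ('D_v (support_fun f xi Z)) q =
    - \sum_i 'D_v (tangential i) q * covector v i q +
    - \sum_i tangential i q * 'D_v (covector v i) q.
  move=> Uq; rewrite (derive_ext v oU (fun z => @derive_support z v) Uq).
  rewrite derive_opp_sum_prod; [|by move=> i; exact: dt|by move=> i; exact: dc].
  by rewrite big_split opprD.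
rewrite (derive_ext v oU D2 hp).
have d1 : derivable (fun q => - \sum_i 'D_v (tangential i) q * covector v i q) p v.
  apply: diff_derivable; apply: (Cn_diff (n := 0%N) (A := U)) hp; apply: CnN => //; apply: Cn_sum => // i _.
  by apply: CnM => //; [exact: smooth_derive (tangential_smooth i) 1%N | exact: covector_smooth].
have d2 : derivable (fun q => - \sum_i tangential i q * 'D_v (covector v i) q) p v.
  apply: diff_derivable; apply: (Cn_diff (n := 0%N) (A := U)) hp; apply: CnN => //; apply: Cn_sum => // i _.
  by apply: CnM => //; [exact: tangential_smooth | exact: smooth_derive (covector_smooth v i) 1%N].
rewrite (deriveD d1 d2) !derive_opp_sum_prod; try by move=> i; auto.
rewrite [X in _ - X]big1 ?subr0 => [|i _]; last by rewrite Dt0 tangential_focal !mul0r addr0.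
congr (- _); apply: eq_bigr => i _; rewrite Dt0 mul0r addr0; congr (_ * _).
pose tr k := transport v k i.
have E q : U q -> 'D_v (tangential i) q =
    - v 0 i + (- (\sum_k tangential k q * tr k q) + support_fun f xi Z q * shape_row v i q).
  by move=> Uq; rewrite derive_tangential // addrA.
rewrite (derive_ext v oU E hp).
have dtr k : differentiable (tr k) p by exact: (smooth_diff (transport_smooth v k i) hp).
have ds : differentiable (shape_row v i) p by exact: (smooth_diff (shape_row_smooth v i) hp).
have dr : differentiable (support_fun f xi Z) p by exact: (smooth_diff support_fun_smooth hp).
have d3 : derivable (fun q => - (\sum_k tangential k q * tr k q)) p v.
  apply: diff_derivable; apply: (Cn_diff (n := 0%N) (A := U)) hp; apply: CnN => //; apply: Cn_sum => // k _.
  by apply: CnM => //; [exact: tangential_smooth | exact: transport_smooth].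
have d4 : derivable (fun q => support_fun f xi Z q * shape_row v i q) p v.
  by apply: diff_derivable; exact: differentiableM.
have d34 := derivableD d3 d4.
rewrite [LHS](@deriveD _ _ _ (cst (- v 0 i)) _ p v (derivable_cst _ _ _) d34) derive_cst add0r.
rewrite [LHS](deriveD d3 d4) derive_opp_sum_prod //; last by move=> k; exact: dt.
rewrite big1 ?oppr0 ?add0r => [|k _]; last by rewrite Dt0 tangential_focal !mul0r addr0.
rewrite [LHS](@deriveM _ _ (support_fun f xi Z) (shape_row v i) p v (diff_derivable dr) (diff_derivable ds)).
by rewrite support_critical scaler0 addr0 support_fun_focal.
Qed.

End CongruenceGeometry.

(** * Two-by-two matrices with a double eigenvalue *)

Lemma det_mx2 (R : comPzRingType) (M : 'M[R]_2) : \det M = M 0 0 * M 1 1 - M 0 1 * M 1 0.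
Proof.
have l0 : lift 0 0 = 1 :> 'I_2 by exact: val_inj.
have l1 : lift 1 0 = 0 :> 'I_2 by exact: val_inj.
rewrite (expand_det_row _ 0) sum_ord2 /cofactor !det_mx11 !mxE l0 l1 /=.
by rewrite expr0 expr1 mul1r mulN1r mulrN.
Qed.

Section DoubleEigenvalue.
Variables (R : realType) (S : 'M[R]_2) (l : R).
Hypothesis hdouble : char_poly S = ('X - l%:P) ^+ 2.

Lemma double_trace : S 0 0 + S 1 1 = 2 * l.
Proof.
have := char_poly_trace S (isT : (0 < 2)%N).
rewrite hdouble /mxtrace sum_ord2 sqrrB !coefE /= => H.
lra.
Qed.

Lemma double_det : S 0 0 * S 1 1 - S 0 1 * S 1 0 = l ^+ 2.
Proof.
have := char_poly_det S; rewrite det_mx2 hdouble expr2 coef0M coefB coefX coefC /= => H.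
have : (0 - l) * (0 - l) = S 0 0 * S 1 1 - S 0 1 * S 1 0 by rewrite H; ring.
by move=> <-; ring.
Qed.

Lemma principal_directionP X : principal_direction S X <->
  [/\ X != 0, (S 0 0 - l) * X 0 0 + S 0 1 * X 0 1 = 0 &
      S 1 0 * X 0 0 + (S 1 1 - l) * X 0 1 = 0].
Proof.
have entry i : (S *m X^T) i 0 = S i 0 * X 0 0 + S i 1 * X 0 1.
  by rewrite mxE sum_ord2 ![X^T _ _]mxE.
split=> [[X0 [mu E]]|[X0 E0 E1]]; last first.
  split=> //; exists l; apply/matrixP => i j; rewrite (ord1 j) entry 2!mxE.
  by elim/ord2P: i; [move: E0 | move: E1]; lra.
have := congr1 (fun M : 'cV_2 => M 0 0) E; have := congr1 (fun M : 'cV_2 => M 1 0) E.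
rewrite !entry !mxE => E1 E0.
have Xn : (X 0 0 != 0) || (X 0 1 != 0).
  rewrite -negb_and; apply: contra X0 => /andP[/eqP x0 /eqP x1].
  by apply/eqP; apply: rV2P; rewrite ?x0 ?x1 !mxE.
(* (mu - l)^2 is the characteristic polynomial at mu, that is det (S - mu). Multiplying (S - mu) X =
   0 by the adjugate shows that it annihilates each coordinate of X, one of which is nonzero. *)
have sq : (mu - l) ^+ 2 = 0.
  have P : (mu - l) ^+ 2 = (S 0 0 - mu) * (S 1 1 - mu) - S 0 1 * S 1 0.
    have tr := double_trace; have dt := double_det.
    have -> : S 1 1 = 2 * l - S 0 0 by lra.
    have -> : S 0 1 * S 1 0 = S 0 0 * S 1 1 - l ^+ 2 by lra.
    have -> : S 1 1 = 2 * l - S 0 0 by lra.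
    ring.
  rewrite P; case/orP: Xn => xn; apply: (mulfI xn); rewrite mulr0.
    have -> : X 0 0 * ((S 0 0 - mu) * (S 1 1 - mu) - S 0 1 * S 1 0) =
      (S 1 1 - mu) * (S 0 0 * X 0 0 + S 0 1 * X 0 1 - mu * X 0 0)
      - S 0 1 * (S 1 0 * X 0 0 + S 1 1 * X 0 1 - mu * X 0 1) by ring.
    by rewrite E0 E1 !subrr !mulr0 subrr.
  have -> : X 0 1 * ((S 0 0 - mu) * (S 1 1 - mu) - S 0 1 * S 1 0) =
    (S 0 0 - mu) * (S 1 0 * X 0 0 + S 1 1 * X 0 1 - mu * X 0 1)
    - S 1 0 * (S 0 0 * X 0 0 + S 0 1 * X 0 1 - mu * X 0 0) by ring.
  by rewrite E0 E1 !subrr !mulr0 subrr.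
have {sq} ml : mu = l by apply/eqP; rewrite -subr_eq0 -sqrf_eq0 sq.
by rewrite ml in E0 E1; split=> //; lra.
Qed.

(** A kernel vector of the nilpotent matrix S - l, written out: (b, l - a) when a differs from l;
    otherwise d = l and b c = 0, and a coordinate vector works. *)
Lemma principal_direction_exists : exists X, principal_direction S X.
Proof.
have tr := double_trace; have dt := double_det.
have [a0|a0] := eqVneq (S 0 0 - l) 0; last first.
  exists (\row_j (if j == 0 then S 0 1 else - (S 0 0 - l))); apply/principal_directionP.
  rewrite !mxE /=; split; last 2 first.
  - by ring.
  - have -> : S 1 1 = 2 * l - S 0 0 by lra.
    have -> : S 1 0 * S 0 1 = S 0 0 * S 1 1 - l ^+ 2 by rewrite mulrC; lra.
    have -> : S 1 1 = 2 * l - S 0 0 by lra.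
    by ring.
  apply/eqP => /rowP /(_ 1); rewrite !mxE /= => /eqP.
  by rewrite oppr_eq0 (negbTE a0).
have d0 : S 1 1 - l = 0 by lra.
have bc : S 0 1 * S 1 0 = 0.
  have -> : S 0 1 * S 1 0 = S 0 0 * S 1 1 - l ^+ 2 by lra.
  have -> : S 0 0 = l by lra.
  have -> : S 1 1 = l by lra.
  by ring.
have [b0|b0] := eqVneq (S 0 1) 0.
  exists (delta_mx 0 1); apply/principal_directionP.
  rewrite a0 b0 d0 !mxE /= !mul0r mulr0 !addr0; split=> //.
  by apply/eqP => /rowP /(_ 1); rewrite !mxE /= => /eqP; rewrite oner_eq0.
have c0 : S 1 0 = 0 by move/eqP: bc; rewrite mulf_eq0 (negbTE b0) => /eqP.
exists (delta_mx 0 0); apply/principal_directionP.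
rewrite a0 c0 d0 !mxE /= !mul0r mulr0 !addr0; split=> //.
by apply/eqP => /rowP /(_ 0); rewrite !mxE /= => /eqP; rewrite oner_eq0.
Qed.

End DoubleEigenvalue.

(** * Derivative of the discriminant *)

Section Discriminant.
Variables (R : realType) (U : set 'rV[R]_2) (f xi : 'rV[R]_2 -> 'rV[R]_3) (p : 'rV[R]_2).
Hypotheses (hcong : line_congruence f xi U) (hU : U p).
Implicit Types v : 'rV[R]_2.

Let oU : open U. Proof. by case: hcong. Qed.

Definition dshape v i j : R := 'D_v (fun q => shape f xi q i j) p.

Lemma discr_smooth : smooth_on U (discr f xi).
Proof.
have sS i j := shape_smooth hcong i j.
move=> n; apply: CnD => //; first by apply: CnX => //; apply: CnB => //; exact: sS.
apply: CnM => //; last exact: sS.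
by apply: CnM => //; [exact: Cn_cst | exact: sS].
Qed.

Lemma derive_discr v : 'D_v (discr f xi) p =
  2 * (shape f xi p 0 0 - shape f xi p 1 1) * (dshape v 0 0 - dshape v 1 1) +
  4 * (dshape v 0 1 * shape f xi p 1 0 + shape f xi p 0 1 * dshape v 1 0).
Proof.
pose s i j (q : 'rV[R]_2) : R := shape f xi q i j.
have dS i j : derivable (s i j) p v.
  by apply: diff_derivable; exact: (smooth_diff (shape_smooth hcong i j) hU).
have -> : discr f xi = (s 0 0 - s 1 1) * (s 0 0 - s 1 1) + ((4 : R) *: s 0 1) * s 1 0.
  by apply/funext => q; rewrite /discr expr2.
have d1 : derivable (s 0 0 - s 1 1) p v := derivableB (dS 0 0) (dS 1 1).
have d2 : derivable ((4 : R) *: s 0 1) p v := @derivableZ _ _ _ (s 0 1) 4 p v (dS 0 1).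
rewrite (deriveD (derivableM d1 d1) (derivableM d2 (dS 1 0))).
rewrite (deriveM d1 d1) (deriveM d2 (dS 1 0)) (deriveB (dS 0 0) (dS 1 1)) (deriveZ 4 (dS 0 1)).
have sE (x y : R) : x *: y = x * y by [].
rewrite !sE -[(s 0 0 - s 1 1) p]/(s 0 0 p - s 1 1 p) -[((4 : R) *: s 0 1) p]/(4 * s 0 1 p).
rewrite -/(dshape v 0 0) -/(dshape v 1 1) -/(dshape v 0 1) -/(dshape v 1 0).
rewrite -/(s 0 0 p) -/(s 1 1 p) -/(s 0 1 p) -/(s 1 0 p).
move: (dshape v 0 0) (dshape v 1 1) (dshape v 0 1) (dshape v 1 0) => *.
by move: (s 0 0 p) (s 1 1 p) (s 0 1 p) (s 1 0 p) => *; ring.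
Qed.

Lemma derive_shape_row v w j :
  'D_w (shape_row f xi v j) p = v 0 0 * dshape w j 0 + v 0 1 * dshape w j 1.
Proof.
have := @derive_sum_prod _ 2 (fun k => cst (v 0 k)) (fun k q => shape f xi q j k) p w.
move=> ->.
- by rewrite sum_ord2 !derive_cst !mul0r !add0r.
- by move=> k; exact: differentiable_cst.
- by move=> k; exact: (smooth_diff (shape_smooth hcong j k) hU).
Qed.

End Discriminant.

Theorem proposition8p1 (R : realType) (U : set 'rV[R]_2)
    (f xi : 'rV[R]_2 -> 'rV[R]_3) (p : 'rV[R]_2) (lambda : R)
    (hcong : line_congruence f xi U)
    (hequi : equiaffine f xi U)
    (hreg : regular_value U (discr f xi) 0)
    (hU : U p)
    (hp : discr f xi p = 0)
    (hdouble : char_poly (shape f xi p) = ('X - lambda%:P) ^+ 2)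
    (hlambda : lambda != 0) :
  Ak_point 2 (support_fun f xi (f p + lambda^-1 *: xi p)) p <->
  regular_discr_point f xi U p.
Proof.
have oU : open U by case: hcong.
pose rho := support_fun f xi (f p + lambda^-1 *: xi p).
have srho : smooth_on U rho := support_fun_smooth _ hcong.
have crit v : 'D_v rho p = 0 := support_critical hcong hequi hU erefl v.
pose a : R := shape f xi p 0 0; pose b : R := shape f xi p 0 1.
pose c : R := shape f xi p 1 0; pose d : R := shape f xi p 1 1.
pose h i j : R := second_form f xi p i j.
have tr : a + d = 2 * lambda := double_trace hdouble.
have dt : a * d - b * c = lambda ^+ 2 := double_det hdouble.
have sdis := discr_smooth hcong.
have Ddis v : 'D_v (discr f xi) p = 2 * (a - d) * (dshape f xi p v 0 0 - dshape f xi p v 1 1) +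
   4 * (dshape f xi p v 0 1 * c + b * dshape f xi p v 1 0) := derive_discr hcong hU v.
(* The discriminant is quadratic in (a - d, b, c), so its differential would vanish where the shape
   operator is scalar, against the regularity of the value 0. *)
have Nne : [|| a - lambda != 0, b != 0 | c != 0].
  apply/negPn/negP; rewrite !negb_or !negbK => /and3P[/eqP a0 /eqP b0 /eqP c0].
  have [v /eqP dv] := hreg p hU hp; apply: dv.
  rewrite -deriveE; last exact: (smooth_diff sdis hU).
  rewrite Ddis b0 c0; have -> : a - d = 0 by lra.
  by rewrite !(mulr0, mul0r, addr0).
have hess v w : 'D_w ('D_v rho) p = - (
   (lambda^-1 * (w 0 0 * a + w 0 1 * b) - w 0 0) * (v 0 0 * h 0 0 + v 0 1 * h 1 0) +
   (lambda^-1 * (w 0 0 * c + w 0 1 * d) - w 0 1) * (v 0 0 * h 0 1 + v 0 1 * h 1 1)).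
  rewrite (support_hessian hcong hequi hU erefl) sum_ord2.
  rewrite !(derive_tangential_focal hcong hequi hU erefl).
  by rewrite /shape_row /covector !sum_ord2.
have hessC v w : 'D_w ('D_v rho) p = 'D_v ('D_w rho) p by exact: Clairaut oU hU (srho 2%N).
pose e i : 'rV[R]_2 := delta_mx 0 i.
have li0 := invr_neq0 hlambda; have l1 : lambda^-1 * lambda = 1 by rewrite mulVf.
(* The entries h(e_i, N e_j) with N = S - lambda. *)
pose n00 := h 0 0 * (a - lambda) + h 0 1 * c; pose n01 := h 0 0 * b + h 0 1 * (d - lambda).
pose n10 := h 1 0 * (a - lambda) + h 1 1 * c; pose n11 := h 1 0 * b + h 1 1 * (d - lambda).
have hessE v w : 'D_w ('D_v rho) p = - (lambda^-1 *
    (v 0 0 * (n00 * w 0 0 + n01 * w 0 1) + v 0 1 * (n10 * w 0 0 + n11 * w 0 1))).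
  have E x y : lambda^-1 * x - y = lambda^-1 * (x - lambda * y) by field.
  by rewrite hess !E /n00 /n01 /n10 /n11; ring.
(* The Hessian of [rho] is - h(., N .) / lambda, and its symmetry is inherited by h(., N .). *)
have sym : n01 = n10.
  have := etrans (esym (hessE (e 0) (e 1))) (etrans (hessC (e 0) (e 1)) (hessE (e 1) (e 0))).
  rewrite /e !mxE /= => E.
  by apply: (mulfI li0); lra.
have hne : h 0 0 * h 1 1 - h 0 1 * h 1 0 != 0.
  by have [_] := hequi p hU; rewrite unitmxE unitfE det_mx2.
(* Stated for an arbitrary principal direction, because [regular_discr_point] quantifies over all of
   them. *)
have key X : principal_direction (shape f xi p) X ->
    Ak_point 2 rho p <-> 'D_X (discr f xi) p != 0.
  move=> /(principal_directionP hdouble)[X0]; rewrite -/a -/b -/c -/d => e0 e1.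
  have Xn : (X 0 0 != 0) || (X 0 1 != 0).
    rewrite -negb_and; apply: contra X0 => /andP[/eqP x0 /eqP x1].
    by apply/eqP; apply: rV2P; rewrite ?x0 ?x1 !mxE.
  have s0 : lambda^-1 * (X 0 0 * a + X 0 1 * b) - X 0 0 = 0.
    have -> : X 0 0 * a + X 0 1 * b = lambda * X 0 0 by lra.
    by rewrite mulrA l1 mul1r subrr.
  have s1 : lambda^-1 * (X 0 0 * c + X 0 1 * d) - X 0 1 = 0.
    have -> : X 0 0 * c + X 0 1 * d = lambda * X 0 1 by lra.
    by rewrite mulrA l1 mul1r subrr.
  have ker v : 'D_v ('D_X rho) p = 0 by rewrite hessC hess s0 s1 !mul0r addr0 oppr0.
  have [mu mu0 pair] := nilpotent_pairing tr dt Nne Xn e0 e1 hne sym.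
  (* One of the two coordinate vectors works. If both diagonal entries vanish, X in the kernel
     forces the off-diagonal entry to vanish too; then h N = 0, and N = 0 since h is invertible. *)
  have [Y YY] : exists Y, 'D_Y ('D_Y rho) p != 0.
    have [n0|n0] := eqVneq n00 0; last first.
      exists (e 0); rewrite hessE /e !mxE /= !(mul1r, mulr1, mul0r, mulr0, add0r, addr0).
      by rewrite oppr_eq0 mulf_neq0.
    have [m0|m0] := eqVneq n11 0; last first.
      exists (e 1); rewrite hessE /e !mxE /= !(mul1r, mulr1, mul0r, mulr0, add0r, addr0).
      by rewrite oppr_eq0 mulf_neq0.
    have z01 : n01 = 0.
      have K v := etrans (esym (hessE v X)) (etrans (hessC v X) (ker v)).
      have := K (e 0); have := K (e 1); rewrite n0 m0 -sym /e !mxE /= => K1 K0.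
      case/orP: Xn => xn; apply: (mulIf xn); apply: (mulfI li0); lra.
    have za : a - lambda = 0.
      apply: (mulfI hne); rewrite mulr0.
      have -> : (h 0 0 * h 1 1 - h 0 1 * h 1 0) * (a - lambda) = h 1 1 * n00 - h 0 1 * n10.
        by rewrite /n00 /n10; ring.
      by rewrite n0 -sym z01 !mulr0 subrr.
    have zb : b = 0.
      apply: (mulfI hne); rewrite mulr0.
      have -> : (h 0 0 * h 1 1 - h 0 1 * h 1 0) * b = h 1 1 * n01 - h 0 1 * n11.
        by rewrite /n01 /n11; ring.
      by rewrite m0 z01 !mulr0 subrr.
    have zc : c = 0.
      apply: (mulfI hne); rewrite mulr0.
      have -> : (h 0 0 * h 1 1 - h 0 1 * h 1 0) * c = h 0 0 * n10 - h 1 0 * n00.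
        by rewrite /n00 /n10; ring.
      by rewrite n0 -sym z01 !mulr0 subrr.
    by move: Nne; rewrite za zb zc eqxx.
  (* [pair] is applied to the entries of D_X S: it turns h(X, (D_X S) X) into mu times D_X discr. *)
  have third : 'D_X ('D_X ('D_X rho)) p = - (lambda^-1 * (mu * 'D_X (discr f xi) p)).
    have Dt i : 'D_X (tangential f xi (f p + lambda^-1 *: xi p) i) p = 0.
      rewrite (derive_tangential_focal hcong hequi hU erefl) /shape_row sum_ord2.
      by elim/ord2P: i.
    have := support_third hcong hequi hU erefl Dt; rewrite -/rho => ->.
    rewrite sum_ord2 !(derive_shape_row hcong hU) /covector !sum_ord2 Ddis -pair.
    move: (dshape f xi p X 0 0) (dshape f xi p X 0 1) (dshape f xi p X 1 0) (dshape f xi p X 1 1).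
    by move=> *; rewrite /h; ring.
  have third0 : ('D_X ('D_X ('D_X rho)) p != 0) = ('D_X (discr f xi) p != 0).
    by rewrite third oppr_eq0 !mulf_eq0 (negbTE li0) (negbTE mu0).
  rewrite -third0; exact: A2_pointP oU hU srho X0 crit ker YY.
have tangent X : X != 0 ->
    tangent_to (discr_curve f xi U) p X <-> 'D_X (discr f xi) p = 0.
  exact: tangent_to_level_set oU hU sdis hp (hreg p hU hp).
split=> [HA X HX HT|HR].
  have /eqP := (key X HX).1 HA; apply; apply/(tangent X); [by case: HX | exact: HT].
(* Regularity is a universal statement, so the converse must first exhibit a principal direction. *)
have [X HX] := principal_direction_exists hdouble.
apply/(key X HX); apply/eqP => H0; apply: (HR X HX); apply/(tangent X) => //.
by case: HX.
Qed.
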